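(* Let $k$ be a perfect field of characteristic $p>0$, let $\sigma\subseteq\mathbb R^n$ be an $n$-dimensional strongly convex rational polyhedral cone, let $\Sigma$ be the fan consisting of $\sigma$ and its faces, and let $R$ be the coordinate ring of the associated affine toric variety $X=X(\Sigma)$ over $k$, with anticanonical polytope $P_{-K_X}$. Let $e>0$. Then $\mathscr D^{(2)}_e(R)$ is generated as a $k$-vector space by the maps $\pi_a$ where $a\in \frac{1}{p^e}\mathbb Z^n \cap \operatorname{int}(P_{-K_X})$ and the interior of $P_{-K_X} \cap ( a - P_{-K_X})$ contains a representative of each equivalence class in $\frac{1}{p^e}\mathbb Z^n / \mathbb Z^n$.
   Context: $R=k[\sigma^\vee\cap\mathbb Z^n]\subseteq k[T]=k[x_1^{\pm1},\dots,x_n^{\pm1}]$. $\Sigma(1)$ is the set of rays of $\sigma$; for $\rho\in\Sigma(1)$, $v_\rho$ is the shortest nonzero vector in $\rho\cap\mathbb Z^n$. The anticanonical polytope is $$P_{-K_X}=\{u\in\mathbb R^n : \langle u,v_\rho\rangle\ge -1\text{ for all }\rho\in\Sigma(1)\},$$ and $a-P_{-K_X}=\{a-u: u\in P_{-K_X}\}$. Put $q=p^e$ and let $\frac1q\mathbb Z^n=\{(a_1/q,\dots,a_n/q): a_i\in\mathbb Z\}$. $R^{1/q}=F^e_*R$ is the ring of $q$-th roots of elements of $R$, an $R$-module; since $k$ is perfect, $k[T]^{1/q}$ has $k$-basis the monomials $x^u=\prod x_i^{u_i}$, $u\in\frac1q\mathbb Z^n$. For $a\in\frac1q\mathbb Z^n$,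 $\pi_a\colon k[T]^{1/q}\to k[T]$ is the $k$-linear map (it is $k[T]$-linear) with $\pi_a(x^u)=x^{a+u}$ if $a+u\in\mathbb Z^n$ and $\pi_a(x^u)=0$ otherwise. For $a\in\frac1q\mathbb Z^n\cap\operatorname{int}(P_{-K_X})$ the map $\pi_a$ sends $R^{1/q}$ into $R$, and these restrictions form a $k$-basis of $\operatorname{Hom}_R(R^{1/q},R)$ (Payne). Let $\mu\colon R\otimes_kR\to R$ be multiplication. $\mathscr D^{(2)}_e(R)$ is the set of $\varphi\in\operatorname{Hom}_R(F^e_*R,R)$ for which there exists $\widehat\varphi\in\operatorname{Hom}_{R\otimes_kR}(F^e_*(R\otimes_kR),R\otimes_kR)$ with $\mu\circ\widehat\varphi=\varphi\circ F^e_*\mu$; here $F^e_*M$ denotes restriction of scalars along the $e$-th iterate of Frobenius. *)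

(* Defs.v *)
From HB Require Import structures.
From mathcomp Require Import all_boot all_order all_algebra finmap.
From mathcomp Require Import all_classical all_reals all_analysis.
From mathcomp Require Import -(notations) monalg.

Set Implicit Arguments.
Unset Strict Implicit.
Unset Printing Implicit Defensive.

Import Order.TTheory GRing.Theory Num.Theory.
Local Open Scope classical_set_scope.
Local Open Scope ring_scope.

(* The monoid algebra k[M] of a commutative monoid M, written additively.
   The type {malg k[M]} of finitely supported functions M -> k comes with a
   ring structure only when the monoid has no nontrivial units, which excludes
   Z^n; here the multiplication is defined for an arbitrary M. *)
Definition monoid_algebra (k : fieldType) (M : nmodType) : Type := malg M k.

Section MonoidAlgebra.
Context (k : fieldType) (M : nmodType).
Local Notation A := (monoid_algebra k M).
Implicit Types (f g h : A) (m : M) (c : k).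

HB.instance Definition _ := GRing.Lmodule.on A.

Definition monomial c m : A := mkmalgU m c.

Definition ma_mul f g : A :=
  \sum_(m1 <- msupp f) \sum_(m2 <- msupp g)
     monomial (mcoeff m1 f * mcoeff m2 g) (m1 + m2).

Local Lemma monomialD m : {morph monomial^~ m : x y / x + y}.
Proof. exact: monalgUD. Qed.

Local Lemma monomial0 m : monomial 0 m = 0.
Proof. exact: monalgU0. Qed.

Local Lemma ma_mulw (d1 d2 : {fset M}) f g :
  (msupp f `<=` d1)%fset -> (msupp g `<=` d2)%fset ->
  ma_mul f g = \sum_(m1 <- d1) \sum_(m2 <- d2)
     monomial (mcoeff m1 f * mcoeff m2 g) (m1 + m2).
Proof.
move=> le1 le2; rewrite /ma_mul (big_fset_incl _ le1) /=.
  apply/eq_bigr=> m1 _; apply/big_fset_incl => // m _ /mcoeff_outdom ->.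
  by rewrite mulr0 monomial0.
move=> m _ /mcoeff_outdom fm.
by rewrite big1 // => m' _; rewrite fm mul0r monomial0.
Qed.

Local Lemma ma_mulC : commutative ma_mul.
Proof.
move=> f g; rewrite /ma_mul exchange_big; apply: eq_bigr => m _.
by apply: eq_bigr => m' _; rewrite mulrC addrC.
Qed.

Local Lemma ma_mul0 : left_zero 0 ma_mul.
Proof. by move=> g; rewrite /ma_mul msupp0 big_seq_fset0. Qed.

Local Lemma ma_mulDl : left_distributive ma_mul +%R.
Proof.
move=> f1 f2 g; rewrite [in RHS](ma_mulw (fsubsetUl _ (msupp f2)) (fsubset_refl _)).
rewrite [in RHS](ma_mulw (fsubsetUr (msupp f1) _) (fsubset_refl _)).
rewrite (ma_mulw (msuppD_le _ _) (fsubset_refl _)).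
rewrite -big_split /=; apply/eq_bigr=> k1 _.
rewrite -big_split /=; apply/eq_bigr=> k2 _.
by rewrite mcoeffD mulrDl monomialD.
Qed.

Local Lemma ma_mulUU c1 c2 m1 m2 :
  ma_mul (monomial c1 m1) (monomial c2 m2) = monomial (c1 * c2) (m1 + m2).
Proof. by rewrite (ma_mulw msuppU_le msuppU_le) !big_seq_fset1 !mcoeffUU. Qed.

Local Lemma ma_sum f : f = \sum_(m <- msupp f) monomial (mcoeff m f) m.
Proof. exact: monalgE. Qed.

Local Lemma ma_mul_suml (I : Type) (r : seq I) (F : I -> A) g :
  ma_mul (\sum_(i <- r) F i) g = \sum_(i <- r) ma_mul (F i) g.
Proof. exact: (big_morph (ma_mul^~ g) (fun _ _ => ma_mulDl _ _ _) (ma_mul0 _)). Qed.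

Local Lemma ma_mul_sumr (I : Type) (r : seq I) (F : I -> A) g :
  ma_mul g (\sum_(i <- r) F i) = \sum_(i <- r) ma_mul g (F i).
Proof. by rewrite ma_mulC ma_mul_suml; apply: eq_bigr => i _; apply: ma_mulC. Qed.

Local Lemma ma_mulA : associative ma_mul.
Proof.
move=> f g h; rewrite (ma_sum f) (ma_sum g) (ma_sum h).
rewrite !(ma_mul_suml (msupp f)); apply: eq_bigr => m1 _.
rewrite !(ma_mul_suml (msupp g)) !(ma_mul_sumr (msupp g)) (ma_mul_suml (msupp g)).
apply: eq_bigr => m2 _; rewrite !(ma_mul_sumr (msupp h)).
by apply: eq_bigr => m3 _; rewrite !ma_mulUU mulrA addrA.
Qed.

Local Lemma ma_mul1 : left_id (monomial 1 0) ma_mul.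
Proof.
move=> g; rewrite [in LHS](ma_sum g) ma_mul_sumr [RHS]ma_sum.
by apply: eq_bigr => m _; rewrite ma_mulUU mul1r add0r.
Qed.

Local Lemma ma_one_neq0 : monomial 1 0 != 0.
Proof.
apply/eqP => /(congr1 (mcoeff 0)) /eqP.
by rewrite /monomial mcoeffUU mcoeff0 oner_eq0.
Qed.

HB.instance Definition _ := GRing.Zmodule_isComNzRing.Build A
  ma_mulA ma_mulC ma_mul1 ma_mulDl ma_one_neq0.

Local Lemma ma_scaleM c f : c *: f = ma_mul (monomial c 0) f.
Proof.
rewrite [in RHS](ma_sum f) ma_mul_sumr [LHS]ma_sum.
rewrite -[RHS](big_fset_incl _ (msuppZ_le c f)) => [|m _ /mcoeff_outdom].
  by apply: eq_bigr => m _; rewrite ma_mulUU add0r mcoeffZ.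
by rewrite ma_mulUU mcoeffZ => ->; rewrite monomial0.
Qed.

Local Lemma ma_scaleAl c f g : c *: (f * g) = (c *: f) * g.
Proof. by rewrite !ma_scaleM; apply: ma_mulA. Qed.

HB.instance Definition _ := GRing.Lmodule_isLalgebra.Build k A ma_scaleAl.
HB.instance Definition _ := GRing.Lalgebra_isComAlgebra.Build k A.

End MonoidAlgebra.

Section LatticeAndCones.
Context {Rr : realType} {n : nat}.
Local Notation V := 'rV[Rr]_n.
Implicit Types (u v : V) (m : 'rV[int]_n) (s t : set V).

Definition of_int m : V := map_mx intr m.

Definition lattice : set V := range of_int.

(* (1/q) Z^n, for q > 0 *)
Definition frac_lattice (q : nat) : set V := [set q%:R^-1 *: v | v in lattice].

Definition dot u v : Rr := \sum_(i < n) u 0 i * v 0 i.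

Definition enorm v : Rr := Num.sqrt (dot v v).

Definition rational_polyhedral_cone s : Prop :=
  exists (r : nat) (g : 'I_r -> 'rV[int]_n),
    s = [set v | exists c : 'I_r -> Rr,
                   (forall i, 0 <= c i) /\ v = \sum_i c i *: of_int (g i)].

Definition strongly_convex s : Prop := s `&` [set - v | v in s] = [set 0].

(* the dimension of a cone is that of the smallest linear subspace containing it *)
Definition cone_dim s (d : nat) : Prop :=
  exists U : {vspace V},
    [/\ forall v, s v -> v \in U,
        forall W : {vspace V}, (forall v, s v -> v \in W) -> (U <= W)%VS
      & \dim U = d].

Definition dual_cone s : set V := [set u | forall v, s v -> 0 <= dot u v].

Definition face t s : Prop :=
  exists2 u, dual_cone s u & t = s `&` [set v | dot u v = 0].

(* s itself is the face cut out by u = 0 *)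
Definition face_fan s : set (set V) := [set t | face t s].

Definition rays (Sigma : set (set V)) : set (set V) :=
  [set rho | Sigma rho /\ cone_dim rho 1].

(* The shortest nonzero lattice vector of a ray; 0 if there is no such vector,
   which does not happen for the rays of a strongly convex rational cone. *)
Definition ray_generator (rho : set V) : V :=
  xget 0 [set v | [/\ rho v, lattice v, v != 0 &
            forall w, rho w -> lattice w -> w != 0 -> enorm v <= enorm w]].

Definition anticanonical_polytope (Sigma : set (set V)) : set V :=
  [set u | forall rho, rays Sigma rho -> -1 <= dot u (ray_generator rho)].

End LatticeAndCones.

(* k[T] = k[x_1^{+-1}, ..., x_n^{+-1}] *)
Notation laurent k n := (monoid_algebra k 'rV[int]_n).

Section ToricRing.
Context (k : fieldType) {Rr : realType} {n : nat} (s : set 'rV[Rr]_n).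

Definition in_toric : {pred laurent k n} :=
  fun f => all (fun m => of_int m \in dual_cone s) (msupp f).

Local Lemma in_toricP (f : laurent k n) :
  reflect (forall m, m \in msupp f -> dual_cone s (of_int m)) (f \in in_toric).
Proof.
by apply: (iffP allP) => H m /H; [move/set_mem | move/mem_set].
Qed.

Local Lemma in_toric_subalg : subalg_closed in_toric.
Proof.
split.
- apply/in_toricP => m; have [->|m0] := eqVneq m 0; last first.
    by rewrite -mcoeff_neq0 mcoeffU (eq_sym 0) (negPf m0) mulr0n eqxx.
  move=> _ v _; rewrite /dot big1 // => i _.
  by rewrite !mxE mul0r.
- move=> c f g /in_toricP hf /in_toricP hg; apply/in_toricP => m.
  move/(fsubsetP (msuppD_le _ _)); rewrite in_fsetU => /orP[|/hg//].
  by move/(fsubsetP (msuppZ_le _ _))/hf.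
- move=> f g /in_toricP hf /in_toricP hg; apply/in_toricP => m.
  rewrite -mcoeff_neq0; apply: contra_neqP => nm.
  rewrite raddf_sum big_seq big1 //= => m1 /hf h1.
  rewrite raddf_sum big_seq big1 //= => m2 /hg h2.
  rewrite mcoeffU; case: eqP => // E; case: nm; rewrite -E => v sv.
  rewrite (_ : dot _ v = dot (of_int m1) v + dot (of_int m2) v).
    by rewrite addr_ge0 ?h1 ?h2.
  rewrite /dot -big_split; apply: eq_bigr => i _.
  by rewrite !mxE intrD mulrDl.
Qed.

HB.instance Definition _ := GRing.isSubalgClosed.Build k (laurent k n) in_toric
  in_toric_subalg.

(* R = k[s^vee \cap Z^n], as a subalgebra of k[T] *)
Record toric_ring : predArgType :=
  ToricRing { toric_val :> laurent k n; _ : toric_val \in in_toric }.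

HB.instance Definition _ := [isSub for toric_val].
HB.instance Definition _ := [Choice of toric_ring by <:].
HB.instance Definition _ := [SubChoice_isSubComNzRing of toric_ring by <:].
HB.instance Definition _ := [SubZmodule_isSubLmodule of toric_ring by <:].
HB.instance Definition _ := [SubNzRing_SubLmodule_isSubLalgebra of toric_ring by <:].
HB.instance Definition _ := [SubLalgebra_isSubAlgebra of toric_ring by <:].

End ToricRing.

(* F^e_* A: the additive group of A, on which r in A acts as multiplication by
   r^(p^e). *)
Definition frob_push (k : fieldType) (p : nat) (hp : p \in [pchar k]) (e : nat)
  (A : comAlgType k) : Type := A.

Section FrobeniusPushforward.
Context (k : fieldType) (p : nat) (hp : p \in [pchar k]) (e : nat).
Context (A : comAlgType k).
Local Notation F := (frob_push hp e A).

HB.instance Definition _ := GRing.Zmodule.on F.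

Definition frob_scale (r : A) (x : F) : F := r ^+ (p ^ e) * (x : A).

Local Lemma frob_scaleA a b x :
  frob_scale a (frob_scale b x) = frob_scale (a * b) x.
Proof. by rewrite /frob_scale mulrA exprMn. Qed.

Local Lemma frob_scale1 : left_id 1 frob_scale.
Proof. by move=> x; rewrite /frob_scale expr1n mul1r. Qed.

Local Lemma frob_scaleDr : right_distributive frob_scale +%R.
Proof. by move=> a x y; rewrite /frob_scale mulrDr. Qed.

Local Lemma frob_scaleDl x : {morph frob_scale^~ x : a b / a + b}.
Proof.
have hA : p \in [pchar A] by rewrite (pchar_lalg A).
move=> a b; rewrite /frob_scale exprDn_pchar ?mulrDl //.
by rewrite (eq_pnat _ (pcharf_eq hA)) pnatX pnat_id // (pcharf_prime hp).
Qed.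

HB.instance Definition _ := GRing.Zmodule_isLmodule.Build A F
  frob_scaleA frob_scale1 frob_scaleDr frob_scaleDl.

End FrobeniusPushforward.

(* Hom_A(F^e_* A, A) *)
Notation frob_hom hp e A := {linear frob_push hp e A -> A^o}.

(* A \otimes_k A, given by its universal property among k-modules; it is a
   k-algebra by (a \otimes b) (a' \otimes b') = aa' \otimes bb'. *)
Record tensor_square (k : fieldType) (A : comAlgType k) := TensorSquare {
  tensor_alg :> comAlgType k;
  tensor : A -> A -> tensor_alg;
  tensor_linearl : forall b, linear (tensor^~ b);
  tensor_linearr : forall a, linear (tensor a);
  tensor_one : tensor 1 1 = 1;
  tensor_mul : forall a b a' b',
    tensor a b * tensor a' b' = tensor (a * a') (b * b');
  tensor_universal : forall (W : lmodType k) (f : A -> A -> W),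
    (forall b, linear (f^~ b)) -> (forall a, linear (f a)) ->
    exists2 g : {linear tensor_alg -> W},
      forall a b, g (tensor a b) = f a b
    & forall g' : {linear tensor_alg -> W},
        (forall a b, g' (tensor a b) = f a b) -> g' =1 g
}.

(* The set D^(2)_e(A).  Since A \otimes_k A is unique up to a unique
   isomorphism, which carries mu to mu, it does not matter which one is used;
   mu is the multiplication map. As maps of sets, F^e_* mu is mu. *)
Definition D2 (k : fieldType) (p : nat) (hp : p \in [pchar k]) (e : nat)
    (A : comAlgType k) : set (frob_hom hp e A) :=
  [set phi | exists (AA : tensor_square A) (mu : {linear AA -> A})
                    (phihat : frob_hom hp e AA),
     (forall a b, mu (tensor AA a b) = a * b) /\
     (forall z : AA, mu (phihat z) = phi (mu z))].

Arguments D2 {k p} hp e A _.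

(* the unique q-th root of c when k is perfect and q is a power of its
   characteristic *)
Definition qroot (k : fieldType) (q : nat) (c : k) : k :=
  xget 0 [set d | d ^+ q = c].

(* The element f = \sum_m f_m x^m of F^e_* k[T] stands for its q-th root
   f^(1/q) = \sum_m f_m^(1/q) x^(m/q) in k[T]^(1/q), where q = p^e. *)
Section PiMaps.
Context (k : fieldType) {Rr : realType} {n : nat} (q : nat).

(* x^u for u in Z^n, and 0 for the other u *)
Definition lattice_monomial (u : 'rV[Rr]_n) : laurent k n :=
  if u \in lattice then monomial 1 (map_mx Num.floor u) else 0.

Definition pi_map (a : 'rV[Rr]_n) (f : laurent k n) : laurent k n :=
  \sum_(m <- msupp f)
     qroot q (mcoeff m f) *: lattice_monomial (a + q%:R^-1 *: of_int m).

End PiMaps.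

Definition k_span (k : fieldType) (W : lmodType k) (S : set W) : set W :=
  [set w | exists (N : nat) (c : 'I_N -> k) (g : 'I_N -> W),
     (forall i, S (g i)) /\ w = \sum_i c i *: g i].

(* Main.v *)
Require Import Defs.
From HB Require Import structures.
From mathcomp Require Import all_boot all_order all_algebra finmap zify ring lra.
From mathcomp Require Import all_classical all_reals all_analysis.
From mathcomp Require Import -(notations) monalg.
Import Order.TTheory GRing.Theory Num.Theory.
Import numFieldNormedType.Exports.
Local Open Scope classical_set_scope.
Local Open Scope ring_scope.

Set Implicit Arguments.
Unset Strict Implicit.
Unset Printing Implicit Defensive.

(** Write q = p^e and S for the lattice points of the dual cone, so that R = k[S].

    The idea. A map of F^e_* R is determined by finitely many scalars: it is a
    combination of the maps pi_a with a in the interior of P. The same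
    description applies to R (x) R, which is the toric ring of the cone
    sigma x sigma, whose polytope is P x P. If a lift is the sum of
    c_(b,b') pi_(b,b') and phi is the sum of c_a pi_a, then comparing
    mu o lift with phi o mu on the monomials x^u (x) x^u' gives, for all u and
    u' in (1/q) S with a + u + u' integral,
      c_a = the sum of c_(b,b') over b + b' = a with b = - u modulo Z^n.
    As (1/q) S meets every class, if c_a is nonzero then each class contains a b
    with b and a - b in the interior of P, which is the condition of the
    theorem. Conversely, given such a b_t in every class t, the sum over t of
    pi_(b_t, a - b_t) lifts pi_a, because exactly one t contributes to each
    monomial.

    To avoid fractions, a point a = b/q is represented by the integral vector b;
    then the coefficient of x^w in pi_(b/q)(f) is the q-th root of the
    coefficient of x^(q w - b) in f ([coef_pi_map]).

    The convex geometry enters through the inner normals v_i of the facets of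
    the dual cone ([facet_system]): they cut out the dual cone, each is
    primitive, and for each i some lattice point lies on the i-th facet only.
    These three properties pass to sigma x sigma ([facet_system_square]) and
    suffice for the description of the maps of F^e_* R ([payne],
    [trace_op_toric]).  They hold for the primitive generators of an irredundant
    generating family of sigma ([toric_facets]), by a theorem of the alternative
    over the integers ([gordan]); strong convexity is what makes this theorem
    applicable.  The same generators turn out to be the ray generators, which
    identifies P and its interior.

    The definition of D^(2)_e allows any model of R (x) R; a lift is
    transported to the toric model by [D2_lift].  The two implications are then
    [lift_liftable] and [liftable_lift]. *)

(** * Gordan's theorem over the integers *)

Section IntegerPairing.
Context {n : nat}.
Implicit Types (u v w : 'rV[int]_n) (c : int).

Definition idot u v : int := \sum_(i < n) u 0 i * v 0 i.

Lemma idotC u v : idot u v = idot v u.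
Proof. by apply: eq_bigr => i _; rewrite mulrC. Qed.

Lemma idotDl u v w : idot (u + v) w = idot u w + idot v w.
Proof. by rewrite /idot -big_split; apply: eq_bigr => i _; rewrite mxE mulrDl. Qed.

Lemma idotZl c u w : idot (c *: u) w = c * idot u w.
Proof. by rewrite /idot mulr_sumr; apply: eq_bigr => i _; rewrite mxE mulrA. Qed.

Lemma idotDr u v w : idot w (u + v) = idot w u + idot w v.
Proof. by rewrite idotC idotDl !(idotC w). Qed.

Lemma idotZr c u w : idot w (c *: u) = c * idot w u.
Proof. by rewrite idotC idotZl (idotC w). Qed.

Lemma idotNl u w : idot (- u) w = - idot u w.
Proof. by rewrite -scaleN1r idotZl mulN1r. Qed.

Lemma idotNr u w : idot w (- u) = - idot w u.
Proof. by rewrite idotC idotNl (idotC w). Qed.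

Lemma idotBl u v w : idot (u - v) w = idot u w - idot v w.
Proof. by rewrite idotDl idotNl. Qed.

Lemma idotBr u v w : idot w (u - v) = idot w u - idot w v.
Proof. by rewrite idotDr idotNr. Qed.

Lemma idot0l w : idot 0 w = 0.
Proof. by rewrite -(scale0r 0) idotZl mul0r. Qed.

Lemma idot0r w : idot w 0 = 0.
Proof. by rewrite idotC idot0l. Qed.

Lemma idot_sumr (I : finType) (J : {pred I}) (F : I -> 'rV[int]_n) w :
  idot w (\sum_(i in J) F i) = \sum_(i in J) idot w (F i).
Proof. exact: (big_morph (idot w) (fun _ _ => idotDr _ _ _) (idot0r w)). Qed.

Lemma idot_suml (I : finType) (J : {pred I}) (F : I -> 'rV[int]_n) w :
  idot (\sum_(i in J) F i) w = \sum_(i in J) idot (F i) w.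
Proof. by rewrite idotC idot_sumr; apply: eq_bigr => i _; rewrite idotC. Qed.

Lemma idot_delta u i : idot (delta_mx 0 i) u = u 0 i.
Proof.
rewrite /idot (bigD1 i) //= big1 ?addr0; first by rewrite mxE !eqxx mul1r.
by move=> j ji; rewrite mxE eqxx (negPf ji) mul0r.
Qed.

Lemma idot_ge0 u : 0 <= idot u u.
Proof. by apply: sumr_ge0 => i _; rewrite -expr2 sqr_ge0. Qed.

Lemma idot_gt0 u : u != 0 -> 0 < idot u u.
Proof.
move=> u0; rewrite lt_def idot_ge0 andbT.
apply: contra_neq u0 => /eqP; rewrite psumr_eq0; last first.
  by move=> i _; rewrite -expr2 sqr_ge0.
move=> /allP h; apply/rowP => i; rewrite mxE; apply/eqP.
by have := h i (mem_index_enum i); rewrite /= mulf_eq0 orbb.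
Qed.

End IntegerPairing.

Lemma idot_row_mx m n (u1 v1 : 'rV[int]_m) (u2 v2 : 'rV[int]_n) :
  idot (row_mx u1 u2) (row_mx v1 v2) = idot u1 v1 + idot u2 v2.
Proof.
rewrite /idot big_split_ord /=; congr (_ + _); apply: eq_bigr => i _.
  by rewrite !row_mxEl.
by rewrite !row_mxEr.
Qed.

Section Gordan.
Context {n : nat} {I : finType}.
Implicit Types (a : I -> 'rV[int]_n) (J : {set I}).

(** The orthogonal projection away from b, scaled by |b|^2 to stay integral, is
    self-adjoint and kills b; so a solution for the projected vectors projects
    to a solution orthogonal to b, and a relation among the projected vectors is
    a relation modulo b. *)
Lemma gordan_modulo J :
  (forall a, (forall l : I -> int, (forall i, 0 <= l i) ->
       \sum_(i in J) l i *: a i = 0 -> forall i, i \in J -> l i = 0) ->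
     exists y, forall i, i \in J -> 0 < idot y (a i)) ->
  forall a (b : 'rV[int]_n),
    (forall (l : I -> int) (c : int), (forall i, 0 <= l i) ->
       \sum_(i in J) l i *: a i = c *: b -> forall i, i \in J -> l i = 0) ->
    exists2 y, idot y b = 0 & forall i, i \in J -> 0 < idot y (a i).
Proof.
move=> gordanJ a b indep; have [b0|b0] := eqVneq b 0.
  have [l l0 sl|y hy] := gordanJ a; last by exists y; rewrite // b0 idot0r.
  by apply: (indep l 0) => //; rewrite scale0r.
have bb := idot_gt0 b0.
have [l l0 sl|y hy] := gordanJ (fun i => idot b b *: a i - idot (a i) b *: b).
  move=> i iJ; apply/eqP; have : idot b b * l i = 0.
    apply: (indep (fun i => idot b b * l i) (\sum_(i in J) l i * idot (a i) b)) => //.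
      by move=> j; rewrite mulr_ge0 // ltW.
    apply/eqP; rewrite scaler_suml -subr_eq0 -sumrB -[X in _ == X]sl.
    apply/eqP/eq_bigr => j _.
    by rewrite scalerBr !scalerA; congr (_ *: _ - _); rewrite mulrC.
  by move/eqP; rewrite mulf_eq0 (gt_eqF bb).
exists (idot b b *: y - idot y b *: b).
  by rewrite idotBl !idotZl mulrC subrr.
move=> i iJ; have := hy i iJ.
by rewrite idotBl idotBr !idotZl !idotZr (idotC b (a i)) (mulrC (idot y b)).
Qed.

(** Either some y is positive on all a_i, or the a_i satisfy a nontrivial relation
    with nonnegative coefficients.  By induction, take y positive on all vectors
    but one, a_k.  If y is not positive on a_k, then no relation holds modulo
    a_k, since y would take opposite signs on its two sides; so some z is
    positive on the other vectors and vanishes on a_k, and N z + a_k works for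
    large N. *)
Lemma gordan J a :
  (forall l : I -> int, (forall i, 0 <= l i) ->
     \sum_(i in J) l i *: a i = 0 -> forall i, i \in J -> l i = 0) ->
  exists y, forall i, i \in J -> 0 < idot y (a i).
Proof.
move: {2}#|J| (leqnn #|J|) => r; elim: r J a => [|r IH] J a.
  rewrite leqn0 cards_eq0 => /eqP -> _; exists 0 => i; by rewrite inE.
have [->|/set0Pn[k kJ]] := eqVneq J finset.set0.
  by move=> _ _; exists 0 => i; rewrite inE.
have sJ l : \sum_(i in J) l i *: a i = l k *: a k + \sum_(i in J :\ k) l i *: a i.
  by rewrite (big_setD1 k).
rewrite (cardsD1 k) kJ ltnS => cJ indep; set J' := J :\ k in cJ sJ *.
have kJ' : k \notin J' by rewrite !inE eqxx.
have J'P i : (i \in J) = (i == k) || (i \in J').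
  by rewrite !inE; case: eqP => // ->.
have ext (l : I -> int) c : (forall i, 0 <= l i) -> 0 <= c ->
    c *: a k + \sum_(i in J') l i *: a i = 0 -> c = 0 /\ forall i, i \in J' -> l i = 0.
  move=> l0 c0 sl; pose l' i := if i == k then c else l i.
  have h i : i \in J -> l' i = 0.
    apply: indep => [j|]; first by rewrite /l'; case: eqP.
    rewrite sJ {1}/l' eqxx -[RHS]sl; congr (_ + _); apply: eq_bigr => j jJ.
    by rewrite /l'; case: eqP jJ kJ' => // -> ->.
  split; first by have := h k kJ; rewrite /l' eqxx.
  move=> i iJ; have := h i; rewrite J'P iJ orbT /l'.
  by case: eqP iJ kJ' => [-> -> //|_ _ _]; apply.
have [l l0 sl i iJ|y hy] := IH J' a cJ.
  by apply: (ext l 0 _ _ _).2; rewrite // scale0r add0r.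
case: (ltP 0 (idot y (a k))) => [yk|yk].
  by exists y => i; rewrite J'P => /orP[/eqP->|/hy].
have [l c l0 sl i iJ|z zk hz] := gordan_modulo (IH J' ^~ cJ) (a := a) (b := a k).
  case: (lerP c 0) => [c0|c0].
    apply: (ext l (- c) _ _ _).2; rewrite ?oppr_ge0 //.
    by rewrite sl scaleNr addNr.
  (* y is nonnegative on the left-hand side of sl and nonpositive on the right *)
  have le0 : \sum_(i in J') l i * idot y (a i) <= 0.
    rewrite (eq_bigr (fun i => idot y (l i *: a i))) => [|j _]; last by rewrite idotZr.
    by rewrite -idot_sumr sl idotZr pmulr_rle0.
  have ge0 j : j \in J' -> 0 <= l j * idot y (a j).
    by move=> jJ; rewrite mulr_ge0 // ltW // hy.
  have /eqP : \sum_(i in J') l i * idot y (a i) = 0.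
    by apply/eqP; rewrite eq_le le0 sumr_ge0.
  rewrite psumr_eq0 // => /allP/(_ i (mem_index_enum i)); rewrite iJ /=.
  by rewrite mulf_eq0 (gt_eqF (hy i iJ)) orbF => /eqP.
have ak0 : a k != 0.
  apply/eqP => ak0.
  have [] := ext (fun=> 0) 1 (fun=> lexx _) ler01 _ => //.
  by rewrite ak0 scaler0 add0r big1 // => i _; rewrite scale0r.
pose N := 1 + \sum_(i in J') `|idot (a k) (a i)|.
exists (N *: z + a k) => i; rewrite J'P idotDl idotZl => /orP[/eqP->|iJ].
  by rewrite zk mulr0 add0r idot_gt0.
have zi := hz i iJ.
have : `|idot (a k) (a i)| <= \sum_(j in J') `|idot (a k) (a j)|.
  by rewrite (bigD1 i) //= lerDl sumr_ge0.
rewrite /N; set S := \sum_(_ in _) _ => leS; nia.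
Qed.

End Gordan.

(** * Irredundant primitive generators of a rational cone *)

Section RealPairing.
Context {Rr : realType} {n : nat}.
Implicit Types (u v w : 'rV[Rr]_n) (c : Rr) (x y : 'rV[int]_n).

Lemma dotC u v : dot u v = dot v u.
Proof. by apply: eq_bigr => i _; rewrite mulrC. Qed.

Lemma dotDl u v w : dot (u + v) w = dot u w + dot v w.
Proof. by rewrite /dot -big_split; apply: eq_bigr => i _; rewrite mxE mulrDl. Qed.

Lemma dotZl c u w : dot (c *: u) w = c * dot u w.
Proof. by rewrite /dot mulr_sumr; apply: eq_bigr => i _; rewrite mxE mulrA. Qed.

Lemma dotBl u v w : dot (u - v) w = dot u w - dot v w.
Proof. by rewrite dotDl -scaleN1r dotZl mulN1r. Qed.

Lemma dotZr c u w : dot w (c *: u) = c * dot w u.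
Proof. by rewrite dotC dotZl (dotC w). Qed.

Lemma dotNr u w : dot w (- u) = - dot w u.
Proof. by rewrite -scaleN1r dotZr mulN1r. Qed.

Lemma dot0r w : dot w 0 = 0.
Proof. by rewrite -(scale0r 0) dotZr mul0r. Qed.

Lemma dotDr u v w : dot w (u + v) = dot w u + dot w v.
Proof. by rewrite dotC dotDl !(dotC w). Qed.

Lemma dot_sumr (I : finType) (P : pred I) (F : I -> 'rV[Rr]_n) w :
  dot w (\sum_(i | P i) F i) = \sum_(i | P i) dot w (F i).
Proof. exact: (big_morph (dot w) (fun _ _ => dotDr _ _ _) (dot0r w)). Qed.

Lemma dot_gt0 u : u != 0 -> 0 < dot u u.
Proof.
move=> u0; rewrite lt_def; apply/andP; split; last first.
  by apply: sumr_ge0 => i _; rewrite -expr2 sqr_ge0.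
apply: contra_neq u0 => /eqP; rewrite psumr_eq0; last first.
  by move=> i _; rewrite -expr2 sqr_ge0.
move=> /allP h; apply/rowP => i; rewrite mxE; apply/eqP.
by have := h i (mem_index_enum i); rewrite /= mulf_eq0 orbb.
Qed.

Lemma of_int_inj : injective (@of_int Rr n).
Proof.
move=> x y /rowP h; apply/rowP => i; have := h i.
by rewrite !mxE => /intr_inj.
Qed.

Lemma of_intD x y : of_int (x + y) = of_int x + of_int y :> 'rV[Rr]_n.
Proof. by apply/rowP => i; rewrite !mxE intrD. Qed.

Lemma of_intB x y : of_int (x - y) = of_int x - of_int y :> 'rV[Rr]_n.
Proof. by apply/rowP => i; rewrite !mxE intrB. Qed.

Lemma of_intZ (c : int) x : of_int (c *: x) = c%:~R *: of_int x :> 'rV[Rr]_n.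
Proof. by apply/rowP => i; rewrite !mxE intrM. Qed.

Lemma of_int0 : of_int 0 = 0 :> 'rV[Rr]_n.
Proof. by apply/rowP => i; rewrite !mxE. Qed.

Lemma of_int_sum (I : finType) (J : {set I}) (F : I -> 'rV[int]_n) :
  of_int (\sum_(i in J) F i) = \sum_(i in J) of_int (F i) :> 'rV[Rr]_n.
Proof. exact: (big_morph _ of_intD of_int0). Qed.

Lemma dot_of_int x y : dot (of_int x) (of_int y) = (idot x y)%:~R :> Rr.
Proof.
rewrite /dot /idot rmorph_sum; apply: eq_bigr => i _ /=.
by rewrite !mxE rmorphM.
Qed.

End RealPairing.

(** The least positive value d of the functional <., g> divides all its values by
    Euclidean division, in particular the coordinates of g. *)
Lemma primitive_multiple n (g : 'rV[int]_n) : g != 0 ->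
  exists (d : int) (v w : 'rV[int]_n), [/\ 0 < d, g = d *: v & idot w v = 1].
Proof.
move=> g0.
have exd : exists d : nat, `[< (0 < d)%N /\ exists w, idot w g = d%:Z >].
  exists `|idot g g|%N; apply/asboolP; have gg := idot_gt0 g0.
  split; first by rewrite absz_gt0 gt_eqF.
  by exists g; rewrite gez0_abs // ltW.
case: (ex_minnP exd) => d /asboolP[d0 [w wg]] dmin.
have dvd i : (d%:Z %| g 0%R i)%Z.
  apply/dvdz_mod0P/eqP; have : (0 <= g 0%R i %% d%:Z)%Z by rewrite modz_ge0 // -lt0n.
  rewrite le_eqVlt => /orP[/eqP/esym/eqP//|r0].
  have : (d <= `|(g 0%R i %% d%:Z)%Z|)%N.
    apply: dmin; apply/asboolP; split; first by rewrite absz_gt0 gt_eqF.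
    exists (delta_mx 0 i - (g 0%R i %/ d%:Z)%Z *: w).
    by rewrite idotBl idotZl wg idot_delta gez0_abs ?ltW.
  have : (g 0%R i %% d%:Z)%Z < d%:Z by rewrite ltz_pmod // ltz_nat.
  by lia.
exists d%:Z, (\row_i (g 0%R i %/ d%:Z)%Z), w.
have gE : g = d%:Z *: \row_i (g 0%R i %/ d%:Z)%Z.
  by apply/rowP => i; rewrite !mxE mulrC divzK.
have d0' : 0 < d%:Z by lia.
split=> //; have {}d0' : d%:Z != 0 by rewrite gt_eqF.
by apply: (mulfI d0'); rewrite -idotZr -gE mulr1.
Qed.

Section Generators.
Context {Rr : realType} {n : nat}.
Implicit Types (s : set 'rV[Rr]_n).

Definition generated_cone (I : finType) (g : I -> 'rV[int]_n) : set 'rV[Rr]_n :=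
  [set v | exists c : I -> Rr, (forall i, 0 <= c i) /\ v = \sum_i c i *: of_int (g i)].

Definition irredundant (I : finType) (g : I -> 'rV[int]_n) : Prop :=
  forall (j : I) (c : I -> Rr), (forall i, 0 <= c i) ->
    of_int (g j) <> \sum_(i | i != j) c i *: of_int (g i).

Lemma irredundant_generators s : rational_polyhedral_cone s ->
  exists (r : nat) (g : 'I_r -> 'rV[int]_n), s = generated_cone g /\ irredundant g.
Proof.
move=> [r0 [g0 sg0]].
have ex : exists r, `[< exists g : 'I_r -> 'rV[int]_n, s = generated_cone g >].
  by exists r0; apply/asboolP; exists g0.
case: (ex_minnP ex) => r /asboolP[g sg] rmin; exists r, g; split=> // j c c0 gj.
case: r j g sg rmin c c0 gj => [[]//|r] j g sg rmin c c0 gj.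
suff /rmin : `[< exists g : 'I_r -> 'rV[int]_n, s = generated_cone g >] by rewrite ltnn.
have gj' : of_int (g j) = \sum_i c (lift j i) *: of_int (g (lift j i)).
  rewrite gj big_mkcond (bigD1_ord j) //= eqxx add0r.
  by apply: eq_bigr => i _; rewrite eq_sym neq_lift.
apply/asboolP; exists (g \o lift j); rewrite sg; apply/seteqP; split=> v [d [d0 ->]].
  exists (fun i => d (lift j i) + d j * c (lift j i)); split.
    by move=> i; rewrite addr_ge0 // mulr_ge0.
  rewrite (bigD1_ord j) //= gj'.
  under [in RHS]eq_bigr do rewrite scalerDl -scalerA.
  by rewrite big_split /= -scaler_sumr addrC.
exists (fun i => oapp d 0 (unlift j i)); split.
  by move=> i; case: unlift => /=.
rewrite (bigD1_ord j) //= unlift_none scale0r add0r.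
by apply: eq_bigr => i _; rewrite liftK.
Qed.

Lemma primitive_generators s : rational_polyhedral_cone s ->
  exists (r : nat) (v : 'I_r -> 'rV[int]_n),
    [/\ s = generated_cone v, irredundant v & forall i, exists w, idot w (v i) = 1].
Proof.
move=> /irredundant_generators[r [g [sg irr]]].
have g0 j : g j != 0.
  apply/eqP => gj; apply: (irr j (fun=> 0)) => //.
  by rewrite big1 ?gj ?of_int0 // => i _; rewrite scale0r.
have /choice[d /choice[v /choice[w H]]] := fun j => primitive_multiple (g0 j).
have d0 i : 0 < (d i)%:~R :> Rr by rewrite ltr0z; case: (H i).
have gE i : of_int (g i) = (d i)%:~R *: of_int (v i) :> 'rV[Rr]_n.
  by rewrite -of_intZ; case: (H i) => _ <-.
have vE i : of_int (v i) = (d i)%:~R^-1 *: of_int (g i) :> 'rV[Rr]_n.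
  by rewrite gE scalerA mulVf ?scale1r // gt_eqF.
exists r, v; split; last by move=> i; exists (w i); case: (H i).
- rewrite sg; apply/seteqP; split=> x [c [c0 ->]].
    exists (fun i => c i * (d i)%:~R); split=> [i|]; first by rewrite mulr_ge0 // ltW.
    by apply: eq_bigr => i _; rewrite gE scalerA.
  exists (fun i => c i / (d i)%:~R); split=> [i|]; first by rewrite divr_ge0 // ltW.
  by apply: eq_bigr => i _; rewrite vE scalerA.
- move=> j c c0 vj; apply: (irr j (fun i => (d j)%:~R * c i / (d i)%:~R)).
    by move=> i; rewrite !mulr_ge0 // ?invr_ge0 ltW.
  rewrite gE vj scaler_sumr; apply: eq_bigr => i _.
  by rewrite vE !scalerA.
Qed.

(** Each term of such a relation is a vector of the cone whose opposite, the sum of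
    the other terms, is also in the cone. *)
Lemma relation_eq0 (I : finType) (v : I -> 'rV[int]_n) (c : I -> Rr) :
  strongly_convex (generated_cone v) -> (forall i, v i != 0) ->
  (forall i, 0 <= c i) -> \sum_i c i *: of_int (v i) = 0 -> forall i, c i = 0.
Proof.
move=> sc v0 c0 sc0 i.
have : (generated_cone v `&` [set - x | x in generated_cone v]) (c i *: of_int (v i)).
  split.
    exists (fun j => if j == i then c i else 0); split; first by move=> j; case: eqP.
    by rewrite (bigD1 i) //= eqxx big1 ?addr0 // => j /negPf->; rewrite scale0r.
  exists (\sum_(j | j != i) c j *: of_int (v j)).
    exists (fun j => if j == i then 0 else c j); split; first by move=> j; case: eqP.
    rewrite [RHS](bigD1 i) //= eqxx scale0r add0r.
    by apply: eq_bigr => j /negPf->.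
  apply/esym/eqP; rewrite -addr_eq0; apply/eqP.
  by rewrite -[RHS]sc0 [RHS](bigD1 i).
rewrite sc => /= /eqP; rewrite scaler_eq0 => /orP[/eqP//|].
by rewrite -of_int0 (inj_eq (@of_int_inj Rr n)) (negPf (v0 i)).
Qed.

(** Gordan's theorem modulo v_j: a relation l with l_i v_i summing to c v_j
    contradicts irredundancy when c > 0, and is trivial by strong convexity when
    c <= 0. *)
Lemma separating_functional (I : finType) (v : I -> 'rV[int]_n) :
  strongly_convex (generated_cone v) -> irredundant v -> (forall i, v i != 0) ->
  forall j, exists2 m, idot m (v j) = 0 & forall i, i != j -> 0 < idot m (v i).
Proof.
move=> sc irr v0 j.
have [l c l0 sl i iJ|m mj mi] :=
    gordan_modulo (gordan (J := [set~ j])) (a := v) (b := v j); last first.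
  by exists m => // i ij; apply: mi; rewrite !inE.
have sl' : \sum_(i | i != j) (l i)%:~R *: of_int (v i) = c%:~R *: of_int (v j) :> 'rV[Rr]_n.
  rewrite -of_intZ -sl of_int_sum; apply: eq_big => [k|k _].
    by rewrite !inE.
  by rewrite of_intZ.
case: (lerP c 0) => [c0|c0]; last first.
  have cR : 0 < c%:~R :> Rr by rewrite ltr0z.
  case: (irr j (fun i => (l i)%:~R / c%:~R)).
    by move=> k; rewrite divr_ge0 ?ler0z // ltW.
  under eq_bigr do rewrite mulrC -scalerA.
  by rewrite -scaler_sumr sl' scalerA mulVf ?scale1r // gt_eqF.
pose l' k : Rr := if k == j then - c%:~R else (l k)%:~R.
have : l' i = 0.
  apply: (relation_eq0 sc v0) => [k|].
    by rewrite /l'; case: eqP => _; rewrite ?oppr_ge0 ?lerz0 ?ler0z.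
  rewrite (bigD1 j) //= {1}/l' eqxx -[RHS](addNr (c%:~R *: of_int (v j))).
  by rewrite scaleNr -sl'; congr (_ + _); apply: eq_bigr => k /negPf kj; rewrite /l' kj.
by rewrite /l'; move: iJ; rewrite !inE => /negPf-> /eqP; rewrite intr_eq0 => /eqP.
Qed.

End Generators.

(** * Facet normals of the dual cone *)

Section FacetSystem.
Context {Rr : realType}.

(** The v_i are the primitive inner normals of the facets of the dual cone of s;
    the third property says that each facet has a lattice point in its relative
    interior.  Only the lattice points of the dual cone are described, as the
    toric ring sees nothing else. *)
Record facet_system (n : nat) (s : set 'rV[Rr]_n) (I : finType)
    (v : I -> 'rV[int]_n) : Prop := FacetSystem {
  facet_dual : forall m, dual_cone s (of_int m) <-> forall i, 0 <= idot m (v i);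
  facet_primitive : forall i, exists w, idot w (v i) = 1;
  facet_separated : forall i,
    exists2 m, idot m (v i) = 0 & forall j, j != i -> 0 < idot m (v j) }.

Section Consequences.
Context (n : nat) (s : set 'rV[Rr]_n) (I : finType) (v : I -> 'rV[int]_n).
Hypothesis hv : facet_system s v.

(** Start from a multiple of a vector of height 1 over the i-th facet and move far
    along a point of the relative interior of that facet. *)
Lemma facet_adjust (B c : int) i :
  exists2 w, idot w (v i) = c & forall j, j != i -> B <= idot w (v j).
Proof.
have [w wi] := facet_primitive hv i; have [m mi mj] := facet_separated hv i.
pose N := \sum_j `|B - idot (c *: w) (v j)|.
exists (c *: w + N *: m); first by rewrite idotDl !idotZl wi mi mulr1 mulr0 addr0.
move=> j ji; rewrite idotDl (idotZl N); have m0 := mj j ji.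
have : `|B - idot (c *: w) (v j)| <= N by rewrite /N (bigD1 j) //= lerDl sumr_ge0.
have N0 : 0 <= N by apply: sumr_ge0.
have : N <= N * idot m (v j) by rewrite ler_peMr.
by move: (N * _) (idot (c *: w) _) => Nm x; lia.
Qed.

Lemma facet_interior (B : int) : exists w, forall i, B <= idot w (v i).
Proof.
have h i : exists w, 0 < idot w (v i) /\ forall j, 0 <= idot w (v j).
  have [w wi wj] := facet_adjust 0 1 i; exists w; rewrite wi; split=> // j.
  by have [->|/wj//] := eqVneq j i; rewrite wi.
have /choice[w H] := h; exists (`|B| *: \sum_i w i) => i.
rewrite idotZl idot_suml (bigD1 i) //=; have [wi _] := H i.
have : 0 <= \sum_(j | j != i) idot (w j) (v i).
  by apply: sumr_ge0 => j _; case: (H j).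
move: wi; set x := idot _ _; set y := \sum_(_ | _) _ => x0 y0.
rewrite (le_trans (ler_norm B)) // ler_peMr //; lia.
Qed.

End Consequences.

Definition cone_square n (s : set 'rV[Rr]_n) : set 'rV[Rr]_(n + n) :=
  [set u | s (lsubmx u) /\ s (rsubmx u)].

Lemma of_int_row_mx n (m1 m2 : 'rV[int]_n) :
  of_int (row_mx m1 m2) = row_mx (of_int m1) (of_int m2) :> 'rV[Rr]_(n + n).
Proof. exact: map_row_mx. Qed.

Lemma dot_row_mx n (u1 u2 v1 v2 : 'rV[Rr]_n) :
  dot (row_mx u1 u2) (row_mx v1 v2) = dot u1 v1 + dot u2 v2.
Proof.
rewrite /dot big_split_ord /=; congr (_ + _); apply: eq_bigr => i _.
  by rewrite !row_mxEl.
by rewrite !row_mxEr.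
Qed.

Lemma dual_cone_square n (s : set 'rV[Rr]_n) m1 m2 : s 0 ->
  dual_cone (cone_square s) (row_mx m1 m2) <-> dual_cone s m1 /\ dual_cone s m2.
Proof.
move=> s0; split=> [h|[h1 h2] x].
  split=> x sx.
    have := h (row_mx x 0); rewrite dot_row_mx dot0r addr0; apply.
    by rewrite /cone_square /= row_mxKl row_mxKr.
  have := h (row_mx 0 x); rewrite dot_row_mx dot0r add0r; apply.
  by rewrite /cone_square /= row_mxKl row_mxKr.
rewrite -(hsubmxK x) /cone_square /= row_mxKl row_mxKr dot_row_mx => -[x1 x2].
by rewrite addr_ge0 ?h1 ?h2.
Qed.

Definition facets_square n (I : finType) (v : I -> 'rV[int]_n) (i : I + I) :=
  match i with inl j => row_mx (v j) 0 | inr j => row_mx 0 (v j) end.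

(** For the separation property, a point of the i-th facet of one factor is
    completed by an interior point of the other dual cone. *)
Lemma facet_system_square n (s : set 'rV[Rr]_n) (I : finType) (v : I -> 'rV[int]_n) :
  s 0 -> facet_system s v -> facet_system (cone_square s) (facets_square v).
Proof.
move=> s0 hv; have [m0 hm0] := facet_interior hv 1.
split.
- move=> m; rewrite -(hsubmxK m) of_int_row_mx dual_cone_square //.
  rewrite !(facet_dual hv); split=> [[h1 h2]|h].
    by case=> j; rewrite /= idot_row_mx idot0r ?addr0 ?add0r.
  split=> i; first by have := h (inl i); rewrite /= idot_row_mx idot0r addr0.
  by have := h (inr i); rewrite /= idot_row_mx idot0r add0r.
- case=> j; have [w wj] := facet_primitive hv j.
    by exists (row_mx w 0); rewrite /= idot_row_mx wj idot0r addr0.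
  by exists (row_mx 0 w); rewrite /= idot_row_mx wj idot0r add0r.
- case=> i; have [m mi mj] := facet_separated hv i.
    exists (row_mx m m0); first by rewrite /= idot_row_mx mi idot0r addr0.
    case=> j ji /=; rewrite idot_row_mx idot0r ?addr0 ?add0r ?mj //.
    by rewrite (lt_le_trans _ (hm0 j)).
  exists (row_mx m0 m); first by rewrite /= idot_row_mx mi idot0r add0r.
  case=> j ji /=; rewrite idot_row_mx idot0r ?addr0 ?add0r ?mj //.
  by rewrite (lt_le_trans _ (hm0 j)).
Qed.

End FacetSystem.

(** * Rays and the anticanonical polytope *)

Section Rays.
Context {Rr : realType} {n r : nat} (s : set 'rV[Rr]_n) (v : 'I_r -> 'rV[int]_n).
Hypothesis sv : s = generated_cone v.
Hypothesis hv : facet_system s v.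

Definition half_line (j : 'I_r) : set 'rV[Rr]_n :=
  [set c *: of_int (v j) | c in [set c | 0 <= c]].

Lemma facet_neq0 j : v j != 0.
Proof.
by have [w] := facet_primitive hv j; apply: contra_eqN => /eqP->; rewrite idot0r.
Qed.

Lemma real_facet_neq0 j : of_int (v j) != 0 :> 'rV[Rr]_n.
Proof. by rewrite -of_int0 (inj_eq (@of_int_inj Rr n)) facet_neq0. Qed.

Lemma generator_in_cone j : s (of_int (v j)).
Proof.
rewrite sv; exists (fun i => (i == j)%:R); split; first by move=> i; rewrite ler0n.
rewrite (bigD1 j) //= eqxx scale1r big1 ?addr0 // => i /negPf->.
by rewrite scale0r.
Qed.

Lemma dual_coneP u : dual_cone s u <-> forall j, 0 <= dot u (of_int (v j)).
Proof.
split=> [h j|h x]; first exact/h/generator_in_cone.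
rewrite sv => -[c [c0 ->]]; rewrite dot_sumr; apply: sumr_ge0 => i _.
by rewrite dotZr mulr_ge0.
Qed.

Lemma half_line_dim j : cone_dim (half_line j) 1.
Proof.
exists <[of_int (v j)]>%VS; split.
- by move=> _ [c _ <-]; rewrite memvZ ?memv_line.
- move=> W hW; rewrite -memvE; apply: hW; exists 1; rewrite /= ?ler01 //.
  exact: scale1r.
- by rewrite dim_vline real_facet_neq0.
Qed.

Lemma half_lineP j x : half_line j x <->
  exists c, [/\ forall i, 0 <= c i, forall i, i != j -> c i = 0
               & x = \sum_i c i *: of_int (v i)].
Proof.
split=> [[c /= c0 <-]|[c [c0 cj ->]]].
  exists (fun i => if i == j then c else 0); split.
  - by move=> i; case: eqP.
  - by move=> i /negPf->.
  - rewrite (bigD1 j) //= eqxx big1 ?addr0 // => i /negPf->.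
    by rewrite scale0r.
exists (c j); first exact: c0.
rewrite (bigD1 j) //= big1 ?addr0 // => i ij.
by rewrite cj ?scale0r.
Qed.

Lemma face_half_line u j : dot u (of_int (v j)) = 0 ->
  (forall i, i != j -> 0 < dot u (of_int (v i))) ->
  s `&` [set x | dot u x = 0] = half_line j.
Proof.
move=> uj ui; apply/seteqP; split=> x.
  rewrite {1}sv => -[[c [c0 ->]] /= ux]; apply/half_lineP; exists c; split=> // i ij.
  have nneg k : true -> 0 <= c k * dot u (of_int (v k)).
    move=> _; apply: mulr_ge0 => //.
    by have [->|/ui/ltW//] := eqVneq k j; rewrite uj.
  move: ux; rewrite dot_sumr; under eq_bigr do rewrite dotZr.
  move/eqP; rewrite psumr_eq0 // => /allP/(_ i (mem_index_enum i)) /=.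
  by rewrite mulf_eq0 (gt_eqF (ui i ij)) orbF => /eqP.
move=> xj; split; last by case: xj => c _ <- /=; rewrite dotZr uj mulr0.
by move/half_lineP: xj => [c [c0 _ ->]]; rewrite sv; exists c.
Qed.

Lemma half_line_ray j : rays (face_fan s) (half_line j).
Proof.
split; last exact: half_line_dim.
have [m mj mi] := facet_separated hv j; exists (of_int m).
  apply/(facet_dual hv) => i.
  by have [->|/mi/ltW//] := eqVneq i j; rewrite mj.
by rewrite (@face_half_line _ j) // => [|i ij]; rewrite dot_of_int ?mj // ltr0z mi.
Qed.

(** A face is generated by the v_i that it contains.  A one-dimensional face
    contains one of them, v_j, and the others in it would be multiples of v_j,
    which the functional separating v_j from them excludes. *)
Lemma ray_half_line rho : rays (face_fan s) rho -> exists j, rho = half_line j.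
Proof.
move=> [[u /dual_coneP du rhoE] [U [hU Umin dU]]].
have [[j uj]|nj] := pselect (exists j, dot u (of_int (v j)) = 0); last first.
  suff /(Umin 0%VS) : forall x, rho x -> x \in 0%VS.
    by rewrite subv0 -dimv_eq0 dU.
  move=> x; rewrite rhoE sv => -[[c [c0 ->]] /= ux].
  move: ux; rewrite dot_sumr (eq_bigr (fun i => c i * dot u (of_int (v i)))) => [|i _]; last first.
    by rewrite dotZr.
  move/eqP; rewrite psumr_eq0 => [/allP h|i _]; last by rewrite mulr_ge0.
  rewrite memv0 big1 // => i _; have := h i (mem_index_enum i).
  rewrite /= mulf_eq0 => /orP[/eqP->|/eqP ui]; first by rewrite scale0r.
  by case: nj; exists i.
exists j; rewrite rhoE; apply: face_half_line => // i ij.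
rewrite lt_def du andbT; apply/eqP => ui.
have inU k : dot u (of_int (v k)) = 0 -> of_int (v k) \in U.
  by move=> uk; apply: hU; rewrite rhoE; split=> //; apply: generator_in_cone.
have UE : <[of_int (v j) : 'rV[Rr]_n]>%VS = U.
  apply/eqP; rewrite eqEdim dU dim_vline (real_facet_neq0 j) andbT.
  by rewrite -memvE inU.
have := inU i ui; rewrite -UE => /vlineP[t vi].
have [m mj mi] := facet_separated hv j.
have : dot (of_int m) (of_int (v i)) = 0 :> Rr.
  by rewrite vi dotZr dot_of_int mj mulr0.
by rewrite dot_of_int => /eqP; rewrite intr_eq0 gt_eqF // mi.
Qed.

(** A functional of value 1 on v_j is integral on lattice points, so the lattice
    points of the half line are the integral multiples of v_j. *)
Lemma ray_generator_half_line j : ray_generator (half_line j) = of_int (v j).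
Proof.
have vj0 := dot_gt0 (real_facet_neq0 j).
have ge1 x : half_line j x -> lattice x -> x != 0 ->
    exists2 c, 1 <= c & x = c *: of_int (v j).
  move=> [c /= c0 <-] [y _ yc] x0; exists c => //.
  have [w wj] := facet_primitive hv j.
  have cE : c = (idot w y)%:~R.
    by rewrite -dot_of_int yc dotZr dot_of_int wj mulr1.
  have : 0 < c by rewrite lt_def c0 andbT; apply: contra_neq x0 => ->; rewrite scale0r.
  by rewrite cE ltr0z ler1z gtz0_ge1.
have normE c : dot (c *: of_int (v j)) (c *: of_int (v j))
             = c ^+ 2 * dot (of_int (v j)) (of_int (v j)) :> Rr.
  by rewrite dotZl dotZr mulrA expr2.
apply: xget_unique.
  split.
  - by exists 1; rewrite /= ?ler01 ?scale1r.
  - by exists (v j).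
  - exact: real_facet_neq0.
  - move=> x xj xl x0; have [c c1 ->] := ge1 x xj xl x0.
    by rewrite /enorm ler_wsqrtr // normE ler_peMl ?exprn_ege1 // ltW.
move=> x [xj xl x0 xmin]; have [c c1 xE] := ge1 x xj xl x0.
have := xmin (of_int (v j)); rewrite xE /enorm ler_sqrt ?(ltW vj0) // normE.
rewrite ger_pMl // => c2; suff -> : c = 1 by rewrite scale1r.
have {}c2 : c ^+ 2 <= 1.
  apply: c2; last exact: real_facet_neq0; last by exists (v j).
  by exists 1; rewrite /= ?ler01 ?scale1r.
by apply/eqP; rewrite eq_le c1 andbT; nra.
Qed.

Lemma anticanonical_polytopeE :
  anticanonical_polytope (face_fan s) = [set u | forall j, -1 <= dot u (of_int (v j))].
Proof.
apply/seteqP; split=> u hu.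
  by move=> j; rewrite -ray_generator_half_line; apply/hu/half_line_ray.
by move=> rho /ray_half_line[j ->]; rewrite ray_generator_half_line; apply: hu.
Qed.

End Rays.

(** All that the algebra below uses about sigma, apart from 0 being in sigma.
    Strong convexity enters through the separating functionals. *)
Lemma toric_facets (Rr : realType) n (s : set 'rV[Rr]_n) :
  rational_polyhedral_cone s -> strongly_convex s ->
  exists (r : nat) (v : 'I_r -> 'rV[int]_n), facet_system s v /\
    anticanonical_polytope (face_fan s) = [set u | forall j, -1 <= dot u (of_int (v j))].
Proof.
move=> /primitive_generators[r [v [sv irr prim]]] sc.
have v0 i : v i != 0.
  by have [w] := prim i; apply: contra_eqN => /eqP->; rewrite idot0r.
have hv : facet_system s v.
  have sc' : strongly_convex (generated_cone v : set 'rV[Rr]_n) by rewrite -sv.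
  split=> //; last exact: separating_functional sc' irr v0.
  move=> m; rewrite (dual_coneP sv); split=> h i.
    by have := h i; rewrite dot_of_int ler0z.
  by rewrite dot_of_int ler0z.
by exists r, v; split=> //; apply: anticanonical_polytopeE sv hv.
Qed.

Lemma continuous_dot (Rr : realType) n (w : 'rV[Rr]_n) : continuous (dot ^~ w).
Proof.
apply: (@continuous_big Rr 'I_n +%R 0 xpredT add_continuous _ _
  (fun i (u : 'rV[Rr]_n) => u 0 i * w 0 i)) => i _ u.
by apply: cvgMr_tmp; [exact: nbhs_filter|exact: coord_continuous].
Qed.

(** From an interior point one can still move a little in the direction - w_i, which
    strictly decreases the i-th functional. *)
Lemma interior_halfspaces (Rr : realType) n (I : finType) (c : I -> Rr)
    (w : I -> 'rV[Rr]_n) : (forall i, w i != 0) ->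
  interior [set u | forall i, c i <= dot u (w i)] = [set u | forall i, c i < dot u (w i)].
Proof.
move=> w0; apply/seteqP; split=> u /= hu; last first.
  apply: (@filterS _ (nbhs u) _ (fun x => forall i, c i < dot x (w i))).
    by move=> x h i; apply/ltW/h.
  apply: (@filter_forall _ I (fun i x => c i < dot x (w i)) (nbhs u)) => i.
  exact: (@cvgr_gt _ _ _ (nbhs_filter u) _ _ (@continuous_dot Rr n (w i) u) _ (hu i)).
move=> i.
have lim : (fun t : Rr => u - t *: w i) @ 0^'+ --> u.
  rewrite -[X in _ --> X]subr0 -(scale0r (w i)).
  apply: cvg_at_right_filter; apply: cvgB; first exact: cvg_cst.
  by apply: cvgZr_tmp; apply: cvg_id.
have near_u : \forall t \near (0 : Rr)^'+, forall j, c j <= dot (u - t *: w i) (w j).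
  exact: (lim _ hu).
have [t [/(_ i) ht t0]] := filter_ex (filterI near_u (nbhs_right_gt (0 : Rr))).
by move: ht; rewrite dotBl dotZl; have := dot_gt0 (w0 i); nra.
Qed.

(** * Coefficients of Laurent polynomials *)

(** Locked: were [mcoeff] and [monomial] to unfold, unification would compute with
    the choice structure of the lattice at every failed match. *)
HB.lock Definition coef (k : fieldType) n (w : 'rV[int]_n) (f : laurent k n) : k :=
  mcoeff w f.

HB.lock Definition mono (k : fieldType) n (c : k) (m : 'rV[int]_n) : laurent k n :=
  monomial c m.

Section MonoidAlgebraTheory.
Context {k : fieldType} {n : nat}.
Local Notation M := 'rV[int]_n.
Local Notation A := (laurent k n).
Implicit Types (f g : A) (m w : M) (c : k).

Lemma coef_monomial c m w : coef w (mono c m : A) = c *+ (m == w).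
Proof. by rewrite coef.unlock mono.unlock; apply: mcoeffU. Qed.

Lemma monoE c m : monomial c m = mono c m :> A.
Proof. by rewrite mono.unlock. Qed.

Lemma mcoeffE f w : mcoeff w f = coef w f.
Proof. by rewrite coef.unlock. Qed.

Lemma coefD f g w : coef w (f + g) = coef w f + coef w g.
Proof. by rewrite coef.unlock; apply: mcoeffD. Qed.

Lemma coefZ c f w : coef w (c *: f) = c * coef w f.
Proof. by rewrite coef.unlock; apply: mcoeffZ. Qed.

Lemma coef0 w : coef w (0 : A) = 0.
Proof. by rewrite coef.unlock; apply: mcoeff0. Qed.

Lemma coef_sum (I : Type) (r : seq I) (P : pred I) (F : I -> A) w :
  coef w (\sum_(i <- r | P i) F i) = \sum_(i <- r | P i) coef w (F i).
Proof. exact: (big_morph (coef w) (fun f g => coefD f g w) (coef0 w)). Qed.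

Lemma coef_outdom f w : w \notin msupp f -> coef w f = 0.
Proof. by rewrite coef.unlock; apply: mcoeff_outdom. Qed.

Lemma coef_neq0 f w : (coef w f != 0) = (w \in msupp f).
Proof. by rewrite coef.unlock; apply: mcoeff_neq0. Qed.

Lemma coefP f g : (forall w, coef w f = coef w g) -> f = g.
Proof. by rewrite coef.unlock => h; apply/malgP. Qed.

Lemma monomialD m c d : mono (c + d) m = mono c m + mono d m :> A.
Proof. by apply: coefP => w; rewrite coefD !coef_monomial mulrnDl. Qed.

Lemma monomialM c1 c2 m1 m2 : mono c1 m1 * mono c2 m2 = mono (c1 * c2) (m1 + m2) :> A.
Proof. by rewrite mono.unlock; apply: Defs.ma_mulUU. Qed.

Lemma sum_monomials f : f = \sum_(m <- msupp f) mono (coef m f) m.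
Proof. by rewrite mono.unlock coef.unlock; apply: monalgE. Qed.

Lemma msupp_monomial c m : (msupp (mono c m : A) `<=` [fset m])%fset.
Proof. by rewrite mono.unlock; apply: msuppU_le. Qed.

Lemma monomial1 : mono 1 0 = 1 :> A.
Proof. by rewrite mono.unlock. Qed.

Lemma monomialZ c d m : c *: mono d m = mono (c * d) m :> A.
Proof. by apply: coefP => w; rewrite coefZ !coef_monomial mulrnAr. Qed.

Lemma monomialX c m i : mono c m ^+ i = mono (c ^+ i) (m *+ i) :> A.
Proof.
elim: i => [|i IH]; first by rewrite !expr0 mulr0n monomial1.
by rewrite !exprS IH monomialM mulrS.
Qed.

Lemma coef_monomialM c m f w : coef w (mono c m * f) = c * coef (w - m) f.
Proof.
rewrite [in LHS](sum_monomials f) [f in RHS]sum_monomials mulr_sumr !coef_sum mulr_sumr.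
apply: eq_bigr => m' _; rewrite monomialM !coef_monomial mulrnAr.
by rewrite -[w in LHS](subrK m) addrC (inj_eq (addIr m)).
Qed.

Lemma morph_add0 (U W : zmodType) (F : U -> W) : {morph F : x y / x + y} -> F 0 = 0.
Proof. by move=> FD; apply: (addrI (F 0)); rewrite -FD !addr0. Qed.

Lemma morph_add_sum (U W : zmodType) (F : U -> W) (I : Type) (r : seq I) (P : pred I)
  (G : I -> U) : {morph F : x y / x + y} ->
  F (\sum_(i <- r | P i) G i) = \sum_(i <- r | P i) F (G i).
Proof. by move=> FD; apply: (big_morph F FD (morph_add0 FD)). Qed.

Lemma additive_ext (W : zmodType) (F G : A -> W) :
  {morph F : x y / x + y} -> {morph G : x y / x + y} ->
  (forall c m, F (mono c m) = G (mono c m)) -> F =1 G.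
Proof.
move=> FD GD FG f; rewrite (sum_monomials f).
by rewrite (morph_add_sum _ _ _ FD) (morph_add_sum _ _ _ GD); apply: eq_bigr.
Qed.

Section SumOverSupport.
Context (W : zmodType) (G : M -> k -> W).

(** The additive extension of a map given on monomials.  The second argument of G is
    the coefficient, so that this also covers maps which are only p^-e-linear
    in it. *)
Definition msum f : W := \sum_(m <- msupp f) G m (coef m f).

Hypothesis GD : forall m, {morph G m : x y / x + y}.

Let G0 m : G m 0 = 0.
Proof. exact: morph_add0. Qed.

Lemma msumE (d : {fset M}) f : (msupp f `<=` d)%fset ->
  msum f = \sum_(m <- d) G m (coef m f).
Proof.
move=> fd; rewrite /msum (big_fset_incl _ fd) // => m _ /coef_outdom->.
exact: G0.
Qed.

Lemma msumD : {morph msum : f g / f + g}.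
Proof.
move=> f g; rewrite (msumE (msuppD_le f g)).
rewrite (msumE (fsubsetUl _ (msupp g))) (msumE (fsubsetUr (msupp f) _)).
by rewrite -big_split; apply: eq_bigr => m _; rewrite coefD GD.
Qed.

Lemma msum_monomial c m : msum (mono c m) = G m c.
Proof. by rewrite (msumE (msupp_monomial c m)) big_seq_fset1 coef_monomial eqxx. Qed.

End SumOverSupport.

Lemma msumZ (W : lmodType k) (h : M -> W) c f :
  msum (fun m d => d *: h m) (c *: f) = c *: msum (fun m d => d *: h m) f.
Proof.
rewrite (msumE _ (msuppZ_le c f)); last by move=> m x y; rewrite scalerDl.
by rewrite scaler_sumr; apply: eq_bigr => m _; rewrite coefZ scalerA.
Qed.

End MonoidAlgebraTheory.

(** * The maps pi over a perfect field *)

Lemma expr_sum_pchar (R : comNzRingType) (p e : nat) (hp : p \in [pchar R]) :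
  {morph (fun x : R => x ^+ (p ^ e)) : x y / x + y}.
Proof.
move=> x y; rewrite exprDn_pchar //.
by rewrite (eq_pnat _ (pcharf_eq hp)) pnatX pnat_id // (pcharf_prime hp).
Qed.

Lemma of_intMn (Rr : realType) n (m : 'rV[int]_n) i :
  of_int (m *+ i) = of_int m *+ i :> 'rV[Rr]_n.
Proof. by elim: i => [|i IH]; rewrite ?mulr0n ?of_int0 // !mulrS of_intD IH. Qed.

Definition fracpt (Rr : realType) n (q : nat) (b : 'rV[int]_n) : 'rV[Rr]_n :=
  q%:R^-1 *: of_int b.

(** Locked for the same reason as [coef]. *)
HB.lock Definition pi_frac (Rr : realType) (k : fieldType) n (q : nat) (b : 'rV[int]_n)
    (f : laurent k n) : laurent k n :=
  pi_map q (fracpt Rr q b) f.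

Section PerfectField.
Context (k : fieldType) (p : nat) (hp : p \in [pchar k])
  (hperf : forall c : k, exists d : k, d ^+ p = c) (e : nat).
Local Notation q := (p ^ e)%N.

Lemma qrootK (c : k) : qroot q c ^+ q = c.
Proof.
rewrite /qroot; apply: (@xgetPex _ 0 [set d : k | d ^+ q = c]).
elim: e c => [|i IH] c; first by exists c; rewrite /= expn0 expr1.
have [d dc] := hperf c; have [d' d'd] := IH d.
by exists d'; rewrite /= expnSr exprM d'd.
Qed.

Lemma expr_pchar_inj : injective (fun c : k => c ^+ q).
Proof.
move=> x y xy; have := expr_sum_pchar e hp (x - y) y; rewrite /= subrK xy.
move/eqP; rewrite -subr_eq addrC addNr eq_sym.
by rewrite expf_eq0 subr_eq0 => /andP[_ /eqP].
Qed.

Lemma qroot_expr (c : k) : qroot q (c ^+ q) = c.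
Proof. by apply: expr_pchar_inj; rewrite /= qrootK. Qed.

Lemma qrootD : {morph @qroot k q : x y / x + y}.
Proof. by move=> x y; apply: expr_pchar_inj; rewrite /= expr_sum_pchar // !qrootK. Qed.

Lemma qrootM : {morph @qroot k q : x y / x * y}.
Proof. by move=> x y; apply: expr_pchar_inj; rewrite /= exprMn !qrootK. Qed.

Lemma qroot0 : qroot q 0 = 0 :> k.
Proof. exact: morph_add0 qrootD. Qed.

Lemma qroot1 : qroot q 1 = 1 :> k.
Proof. by rewrite -[X in qroot _ X](expr1n _ q) qroot_expr. Qed.

Context {Rr : realType}.

Lemma q_gt0 : (0 < q)%N.
Proof. by rewrite expn_gt0 prime_gt0 // (pcharf_prime hp). Qed.

Local Notation frac b := (fracpt Rr q b).

Lemma fracpt_lattice n (b w : 'rV[int]_n) : frac b = of_int w <-> b = w *+ q.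
Proof.
have q0 : q%:R != 0 :> Rr by rewrite pnatr_eq0 -lt0n q_gt0.
rewrite /fracpt; split=> [h|->].
  apply: (@of_int_inj Rr); rewrite of_intMn -h -scaler_nat scalerA.
  by rewrite mulfV ?scale1r.
by rewrite of_intMn -(scaler_nat q (of_int w)) scalerA mulVf ?scale1r.
Qed.

Lemma coef_lattice_monomial n (b w : 'rV[int]_n) :
  coef w (lattice_monomial k (frac b)) = (b == w *+ q)%:R.
Proof.
rewrite /lattice_monomial monoE; case: ifPn => [/set_mem[y _ yb]|bl].
  have -> : map_mx Num.floor (frac b) = y.
    by apply/rowP => i; rewrite -yb !mxE intrKfloor.
  rewrite coef_monomial; congr (_ *+ nat_of_bool _).
  have /fracpt_lattice -> := esym yb.
  apply/eqP/eqP => [->//|/rowP yw]; apply/rowP => i; have := yw i.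
  by rewrite !mulmxnE; apply: pmulrnI q_gt0 _ _.
rewrite coef0; case: eqP => // /fracpt_lattice h.
by move: bl; rewrite h => /negP[]; apply/mem_set; exists w.
Qed.

Lemma coef_pi_map n (b w : 'rV[int]_n) (f : laurent k n) :
  coef w (pi_frac Rr q b f) = qroot q (coef (w *+ q - b) f).
Proof.
rewrite pi_frac.unlock /pi_map coef_sum [f in RHS]sum_monomials coef_sum (morph_add_sum _ _ _ qrootD).
apply: eq_bigr => m _; rewrite mcoeffE coefZ -scalerDr -of_intD coef_lattice_monomial.
rewrite coef_monomial [b + m]addrC eq_sym -subr_eq eq_sym.
by case: eqP; rewrite ?mulr1 // mulr0 mulr0n qroot0.
Qed.

Lemma pi_mapD n (b : 'rV[int]_n) :
  {morph @pi_frac Rr k n q b : f g / f + g}.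
Proof. by move=> f g; apply: coefP => w; rewrite [RHS]coefD !coef_pi_map coefD qrootD. Qed.

(** In characteristic p the power g^q is additive in g, so g may be taken to be a
    monomial, for which the identity is read off the coefficients. *)
Lemma pi_map_frobenius n (b : 'rV[int]_n) (f g : laurent k n) :
  pi_frac Rr q b (g ^+ q * f) = g * pi_frac Rr q b f.
Proof.
have hpA : p \in [pchar (laurent k n)] by rewrite pchar_lalg.
move: g; apply: additive_ext => [g g'|g g'|c m].
- by rewrite (expr_sum_pchar e hpA) mulrDl pi_mapD.
- by rewrite mulrDl.
apply: coefP => w; rewrite coef_pi_map monomialX !coef_monomialM coef_pi_map.
by rewrite qrootM qroot_expr mulrnBl addrAC.
Qed.

End PerfectField.

(** * Monomials of a toric ring *)

Section ToricMonomials.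
Context (k : fieldType) {Rr : realType} {n : nat} (s : set 'rV[Rr]_n).
Local Notation R := (toric_ring k s).
Implicit Types (f g : R) (m : 'rV[int]_n) (c : k).

Lemma toric_valD f g : toric_val (f + g) = toric_val f + toric_val g.
Proof. by []. Qed.

Lemma toric_valM f g : toric_val (f * g) = toric_val f * toric_val g.
Proof. by []. Qed.

Lemma toric_valZ c f : toric_val (c *: f) = c *: toric_val f.
Proof. by []. Qed.

Lemma toric_valX f i : toric_val (f ^+ i) = toric_val f ^+ i.
Proof. by elim: i => [|i IH] //; rewrite !exprS toric_valM IH. Qed.

Lemma toric_val_inj : injective (@toric_val k Rr n s).
Proof. exact: val_inj. Qed.

Lemma toric_supp f m : m \in msupp (toric_val f) -> dual_cone s (of_int m).
Proof. by case: f => f /= /Defs.in_toricP; apply. Qed.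

(** The junk value 0 off the dual cone makes this total in m, hence usable inside sums
    over supports. *)
Definition toric_monomial c m : R := insubd 0 (mono c m).

Lemma toric_monomialE c m : dual_cone s (of_int m) ->
  toric_val (toric_monomial c m) = mono c m.
Proof.
move=> sm; rewrite /toric_monomial -[LHS]/(val _) val_insubd ifT //.
apply/Defs.in_toricP => m' h; suff -> : m' = m by [].
apply/eqP; move: h; rewrite -coef_neq0 coef_monomial [m' == m]eq_sym.
by case: (m == m'); rewrite ?mulr0n ?eqxx.
Qed.

Lemma toric_sum_monomials f :
  f = \sum_(m <- msupp (toric_val f)) toric_monomial (coef m (toric_val f)) m.
Proof.
apply: toric_val_inj; rewrite (morph_add_sum _ _ _ toric_valD).
rewrite [LHS]sum_monomials big_seq [RHS]big_seq; apply: eq_bigr => m mf.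
by rewrite toric_monomialE //; apply: toric_supp mf.
Qed.

Lemma toric_additive_ext (W : zmodType) (F G : R -> W) :
  {morph F : x y / x + y} -> {morph G : x y / x + y} ->
  (forall c m, dual_cone s (of_int m) -> F (toric_monomial c m) = G (toric_monomial c m)) ->
  F =1 G.
Proof.
move=> FD GD FG f; rewrite (toric_sum_monomials f).
rewrite (morph_add_sum _ _ _ FD) (morph_add_sum _ _ _ GD).
rewrite big_seq [RHS]big_seq; apply: eq_bigr => m mf.
by apply: FG; apply: toric_supp mf.
Qed.

Lemma dual_coneD m1 m2 : dual_cone s (of_int m1) -> dual_cone s (of_int m2) ->
  dual_cone s (of_int (m1 + m2)).
Proof. by move=> h1 h2 x sx; rewrite of_intD dotDl addr_ge0 ?h1 ?h2. Qed.

Lemma dual_coneMn m i : dual_cone s (of_int m) -> dual_cone s (of_int (m *+ i)).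
Proof.
move=> h; elim: i => [|i IH]; last by rewrite mulrS; apply: dual_coneD.
by move=> x _; rewrite mulr0n of_int0 dotC dot0r.
Qed.

Lemma dual_cone0 : dual_cone s (of_int 0).
Proof. by move=> x _; rewrite of_int0 dotC dot0r. Qed.

Lemma toric_monomialM c1 c2 m1 m2 :
  dual_cone s (of_int m1) -> dual_cone s (of_int m2) ->
  toric_monomial c1 m1 * toric_monomial c2 m2 = toric_monomial (c1 * c2) (m1 + m2).
Proof.
move=> h1 h2; apply: toric_val_inj.
by rewrite toric_valM !toric_monomialE ?monomialM //; apply: dual_coneD.
Qed.

Lemma toric_monomialX c m i : dual_cone s (of_int m) ->
  toric_monomial c m ^+ i = toric_monomial (c ^+ i) (m *+ i).
Proof.
move=> h; apply: toric_val_inj.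
by rewrite toric_valX !toric_monomialE ?monomialX //; apply: dual_coneMn.
Qed.

Lemma toric_monomialZ c d m : dual_cone s (of_int m) ->
  c *: toric_monomial d m = toric_monomial (c * d) m.
Proof.
by move=> h; apply: toric_val_inj; rewrite toric_valZ !toric_monomialE ?monomialZ.
Qed.

End ToricMonomials.

Lemma finite_support_fun (k : fieldType) n (c : 'rV[int]_n -> k) (L : seq 'rV[int]_n) :
  (forall b, c b != 0 -> b \in L) ->
  exists g : laurent k n, forall b, coef b g = c b.
Proof.
move=> cL; exists (\sum_(b <- undup L) mono (c b) b) => b; rewrite coef_sum.
have [bL|bL] := boolP (b \in L).
  rewrite (bigD1_seq b) ?mem_undup ?undup_uniq //= coef_monomial eqxx big1 ?addr0 //.
  by move=> b' /negPf b'b; rewrite coef_monomial b'b.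
rewrite big_seq big1 => [|b']; first by apply/esym/eqP; apply: contraNT bL => /cL.
rewrite mem_undup coef_monomial => b'L; case: eqP => // b'b.
by move: bL; rewrite -b'b b'L.
Qed.

Lemma idotMnl n (u w : 'rV[int]_n) i : idot (u *+ i) w = i%:Z * idot u w.
Proof.
elim: i => [|i IH]; first by rewrite mulr0n idot0l mul0r.
by rewrite mulrS idotDl IH intS mulrDl mul1r.
Qed.

(** The representative of a class of Z^n / q Z^n with coordinates in [0, q). *)
Definition residue_rep n q (t : 'rV['I_q]_n) : 'rV[int]_n :=
  map_mx (fun i : 'I_q => (i : nat)%:Z) t.

Lemma residue_repP n q (m : 'rV[int]_n) : (0 < q)%N ->
  exists (t : 'rV['I_q]_n) d, m = residue_rep t + d *+ q.
Proof.
move=> q0; have qz : (q%:Z != 0)%Z by rewrite eqz_nat -lt0n.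
have h i : (`|(m 0%R i %% q%:Z)%Z| < q)%N.
  have : (m 0%R i %% q%:Z)%Z < q%:Z by rewrite ltz_pmod.
  have : 0 <= (m 0%R i %% q%:Z)%Z by rewrite modz_ge0.
  by lia.
exists (\row_i Ordinal (h i)), (\row_i (m 0%R i %/ q%:Z)%Z); apply/rowP => i.
rewrite !mxE mulmxnE !mxE /= gez0_abs ?modz_ge0 // {1}(divz_eq (m 0 i) q) addrC.
by rewrite -mulr_natr natz.
Qed.

Lemma residue_rep_inj n q (t t' : 'rV['I_q]_n) d :
  residue_rep t = residue_rep t' + d *+ q -> t = t'.
Proof.
move=> /rowP h; apply/rowP => i; have := h i.
rewrite !mxE mulmxnE -mulr_natr natz => E; apply: ord_inj; move: E.
have := ltn_ord (t 0 i); have := ltn_ord (t' 0 i).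
move: (t 0 i : nat) (t' 0 i : nat) (d 0 i) => x y z yq xq E.
have [z0|[z0|z0]] : z = 0 \/ 1 <= z \/ z <= -1 by lia.
- by move: E; rewrite z0; lia.
- by nia.
- by nia.
Qed.

(** * Maps of the Frobenius pushforward of a toric ring *)

(** b/q lies in the interior of the polytope. *)
Definition inner_point (q n : nat) (I : finType) (v : I -> 'rV[int]_n)
    (b : 'rV[int]_n) : Prop :=
  forall i, - q%:Z < idot b (v i).

(** The combination of the maps pi_(b/q) whose coefficients are those of g: encoding
    the finitely supported coefficient family as a Laurent polynomial makes the
    correspondence between maps and families additive. *)
Definition trace_op (Rr : realType) (k : fieldType) (n q : nat) (g f : laurent k n) :
    laurent k n :=
  msum (fun b c => c *: pi_frac Rr q b f) g.

Section Payne.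
Context (k : fieldType) (p : nat) (hp : p \in [pchar k])
  (hperf : forall c : k, exists d : k, d ^+ p = c) (e : nat).
Local Notation q := (p ^ e)%N.
Context {Rr : realType} {n : nat} (s : set 'rV[Rr]_n).
Context (I : finType) (v : I -> 'rV[int]_n).
Hypothesis hv : facet_system s v.
Local Notation inner_point := (inner_point q v).
Local Notation trace_op := (@trace_op Rr k n q).
Local Notation R := (toric_ring k s).

Lemma trace_opDl f : {morph trace_op^~ f : g h / g + h}.
Proof. by apply: msumD => b c d; rewrite scalerDl. Qed.

Lemma trace_op_mono c b f : trace_op (mono c b) f = c *: pi_frac Rr q b f.
Proof. by rewrite /trace_op msum_monomial // => m x y; rewrite scalerDl. Qed.

Lemma trace_opDr g : {morph trace_op g : x y / x + y}.
Proof.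
move=> x y; rewrite /trace_op /msum -big_split; apply: eq_bigr => b _ /=.
by rewrite (pi_mapD hp hperf) scalerDr.
Qed.

Lemma trace_op_frobenius g x y : trace_op g (x ^+ q * y) = x * trace_op g y.
Proof.
rewrite /trace_op /msum mulr_sumr; apply: eq_bigr => b _.
by rewrite (pi_map_frobenius hp hperf) scalerAr.
Qed.

Lemma coef_trace_op_mono g c m w :
  coef w (trace_op g (mono c m)) = qroot q c * coef (w *+ q - m) g.
Proof.
move: g; apply: additive_ext => [g h|g h|d b].
- by rewrite trace_opDl coefD.
- by rewrite coefD mulrDr.
rewrite trace_op_mono coefZ (coef_pi_map hp hperf) !coef_monomial.
have -> : (m == w *+ q - b) = (b == w *+ q - m) by apply/eqP/eqP => ->; rewrite subKr.
by case: eqP; rewrite ?mulr1n ?mulr0n ?(qroot0 hp hperf) ?mulr0 // mulrC.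
Qed.

(** Every class modulo q Z^n has a representative in the dual cone, since that cone
    has interior lattice points. *)
Lemma residue_lift b : exists w, dual_cone s (of_int (w *+ q - b)).
Proof.
have q0 := q_gt0 hp e.
have [t ht] := facet_interior hv (\sum_i `|idot b (v i)|); exists t.
apply/(facet_dual hv) => i; rewrite idotBl idotMnl; have := ht i.
have : `|idot b (v i)| <= \sum_i `|idot b (v i)|.
  by rewrite (bigD1 i) //= lerDl sumr_ge0.
by move: (\sum_i _) => S; nia.
Qed.

(** If w = (b + m)/q is integral, with b inner and m in the dual cone, then every
    <w, v_i> is an integer > -1, hence nonnegative. *)
Lemma trace_op_toric g : (forall b, b \in msupp g -> inner_point b) ->
  forall f : R, trace_op g (toric_val f) \in in_toric s.
Proof.
move=> hg f; apply/Defs.in_toricP => w; rewrite -coef_neq0 => hw.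
apply/(facet_dual hv) => i.
move: hw; rewrite /trace_op /msum coef_sum => hw.
have [b [bg hb]] : exists b, b \in msupp g /\ coef w (pi_frac Rr q b f) != 0.
  apply: contrapT => hn; move/eqP: hw; apply; rewrite big_seq big1 // => b bg.
  rewrite coefZ; have [->|nz] := eqVneq (coef w (pi_frac Rr q b f)) 0.
    by rewrite mulr0.
  by case: hn; exists b.
have := hg b bg i.
move: hb; rewrite (coef_pi_map hp hperf).
have [->|nz _] := eqVneq (coef (w *+ q - b) f) 0.
  by rewrite (qroot0 hp hperf) eqxx.
have := nz; rewrite coef_neq0 => /toric_supp /(facet_dual hv) /(_ i).
have := q_gt0 hp e; rewrite idotBl idotMnl => q0 h1 h2; nia.
Qed.

Lemma frob_hom_of (F : R -> laurent k n) :
  (forall f, F f \in in_toric s) -> {morph F : x y / x + y} ->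
  (forall g f, F (g ^+ q * f) = toric_val g * F f) ->
  exists phi : frob_hom hp e R, forall f, toric_val (phi f) = F f.
Proof.
move=> Fs FD FM; pose G (f : frob_push hp e R) : R^o := ToricRing (Fs f).
have Gl : linear G.
  move=> a x y; apply: toric_val_inj; rewrite /G /= -FM -FD.
  by congr F.
pose L := GRing.isLinear.Build _ _ _ _ G Gl.
pose phi : {linear frob_push hp e R -> R^o} := HB.pack G L.
by exists phi.
Qed.

Lemma frob_homD (phi : frob_hom hp e R) (x y : R) : phi (x + y) = phi x + phi y.
Proof. exact: (linearD phi). Qed.

Lemma frob_homM (phi : frob_hom hp e R) (r x : R) : phi (r ^+ q * x) = r * phi x.
Proof. exact: (linearZ_LR phi r x). Qed.

(** The coefficient of x^w in phi(x^m) depends only on q w - m: multiplying x^m by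
    (x^d)^q multiplies its image by x^d, and any two monomials whose exponents
    differ by q Z^n have a common multiple of this kind.  This defines the
    scalar c_b for b = q w - m.  If b is not inner, say <b, v_i> <= - q, choose
    w with <w, v_i> = -1 and <w, v_j> large for j <> i; then m = q w - b is in
    the dual cone, but w is not, so c_b = 0. *)
Lemma payne (phi : frob_hom hp e R) :
  exists2 g : laurent k n, forall b, b \in msupp g -> inner_point b
    & forall f : R, toric_val (phi f) = trace_op g (toric_val f).
Proof.
have q0 := q_gt0 hp e.
pose psi m := toric_val (phi (toric_monomial s 1 m)).
have psiM m d w : dual_cone s (of_int m) -> dual_cone s (of_int d) ->
    coef (w + d) (psi (m + d *+ q)) = coef w (psi m).
  move=> sm sd; have -> : psi (m + d *+ q) = mono 1 d * psi m.
    rewrite /psi -(toric_monomialE 1 sd) -toric_valM -frob_homM.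
    rewrite toric_monomialX // toric_monomialM //; last exact: dual_coneMn.
    by rewrite expr1n mul1r [m + _]addrC.
  by rewrite coef_monomialM mul1r addrK.
(* d is a difference of elements of S, namely d + t and t for t far inside *)
have psi_shift m d w : dual_cone s (of_int m) -> dual_cone s (of_int (m + d *+ q)) ->
    coef (w + d) (psi (m + d *+ q)) = coef w (psi m).
  move=> sm smd; have [t ht] := facet_interior hv (\sum_i `|idot d (v i)|).
  have st : dual_cone s (of_int t).
    apply/(facet_dual hv) => i; apply: le_trans (ht i); exact: sumr_ge0.
  have sdt : dual_cone s (of_int (d + t)).
    apply/(facet_dual hv) => i; rewrite idotDl; have := ht i.
    have : `|idot d (v i)| <= \sum_i `|idot d (v i)|.
      by rewrite (bigD1 i) //= lerDl sumr_ge0.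
    by move: (\sum_i _) => S; lia.
  rewrite -(psiM _ t) // -addrA -addrA -mulrnDl; exact: psiM.
have [w0 hw0] := choice residue_lift.
pose c b := coef (w0 b) (psi (w0 b *+ q - b)).
have cE m w : dual_cone s (of_int m) -> coef w (psi m) = c (w *+ q - m).
  move=> sm; rewrite /c; set b := w *+ q - m.
  have E : w0 b *+ q - b = m + (w0 b - w) *+ q.
    by rewrite /b mulrnBl opprB addrCA addrC.
  have := hw0 b; rewrite E => h.
  by rewrite -(psi_shift m (w0 b - w)) // addrC subrK.
have c_inner b : c b != 0 -> inner_point b.
  move=> cb i; rewrite ltNge; apply/negP => bi.
  have [w wi wj] := facet_adjust hv (\sum_j `|idot b (v j)|) (-1) i.
  have sm : dual_cone s (of_int (w *+ q - b)).
    apply/(facet_dual hv) => j; rewrite idotBl idotMnl.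
    have [->|ji] := eqVneq j i; first by rewrite wi; lia.
    have := wj j ji; have : `|idot b (v j)| <= \sum_i `|idot b (v i)|.
      by rewrite (bigD1 j) //= lerDl sumr_ge0.
    by move: (\sum_i _) => S; nia.
  move: cb; rewrite -[b in c b](subKr (w *+ q)) -cE // coef_neq0 => /toric_supp.
  by move=> /(facet_dual hv)/(_ i); rewrite wi.
(* only the b of the form q w - m_t, for m_t a lift of the residue t and w in
   the support of phi(x^(m_t)), can contribute *)
pose mt (t : 'rV['I_q]_n) := w0 (- residue_rep t) *+ q + residue_rep t.
have smt t : dual_cone s (of_int (mt t)).
  by have := hw0 (- residue_rep t); rewrite opprK.
have [g hg] : exists g : laurent k n, forall b, coef b g = c b.
  apply: (finite_support_fun
    (L := flatten [seq [seq w *+ q - mt t | w <- msupp (psi (mt t))] | t <- enum 'rV['I_q]_n])).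
  move=> b cb; have [t [d bE]] := residue_repP (- b) q0.
  apply/flattenP; exists [seq w *+ q - mt t | w <- msupp (psi (mt t))].
    by apply/mapP; exists t; rewrite ?mem_enum.
  have bw : b = (w0 (- residue_rep t) - d) *+ q - mt t.
    rewrite /mt mulrnBl opprD addrACA subrr add0r.
    by rewrite -[LHS]opprK bE opprD addrC.
  apply/mapP; exists (w0 (- residue_rep t) - d) => //.
  by rewrite -coef_neq0 cE // -bw.
exists g => [b|].
  by rewrite -coef_neq0 hg => /c_inner.
apply: toric_additive_ext => [x y|x y|d m sm].
- by rewrite frob_homD.
- by rewrite toric_valD trace_opDr.
have -> : toric_monomial s d m = toric_monomial s (qroot q d) 0 ^+ q * toric_monomial s 1 m.
  rewrite toric_monomialX ?toric_monomialM ?(qrootK hperf) ?mulr1 ?mul0rn ?add0r //.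
  - exact: dual_cone0.
  - exact: dual_cone0.
rewrite frob_homM toric_valM toric_valM toric_valX trace_op_frobenius; congr (_ * _).
rewrite toric_monomialE //; apply: coefP => w.
by rewrite coef_trace_op_mono (qroot1 hp hperf) mul1r hg -cE.
Qed.

End Payne.

(** * Lifts do not depend on the model of the tensor square *)

Section TensorSquares.
Context (k : fieldType) (A : comAlgType k).
Implicit Types (T : tensor_square A).

Lemma tensor_ext T (W : lmodType k) (g g' : T -> W) : linear g -> linear g' ->
  (forall a b, g (tensor T a b) = g' (tensor T a b)) -> g =1 g'.
Proof.
move=> gl gl' gg'.
pose h : {linear T -> W} := HB.pack g (GRing.isLinear.Build _ _ _ _ g gl).
pose h' : {linear T -> W} := HB.pack g' (GRing.isLinear.Build _ _ _ _ g' gl').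
have bl b : linear (fun a => g (tensor T a b)) by move=> c x y; rewrite tensor_linearl gl.
have br a : linear (fun b => g (tensor T a b)) by move=> c x y; rewrite tensor_linearr gl.
have [f _ uniq] := tensor_universal T (f := fun a b => g (tensor T a b)) bl br.
have hf := uniq h (fun a b => erefl); have h'f := uniq h' (fun a b => esym (gg' a b)).
by move=> z; apply: etrans (hf z) (esym (h'f z)).
Qed.

Lemma tensor_compare T T' : exists2 g : {linear T -> T'},
  (forall a b, g (tensor T a b) = tensor T' a b) & (forall y z, g (y * z) = g y * g z).
Proof.
have [g gE _] := tensor_universal T (tensor_linearl T') (tensor_linearr T').
exists g => // y z; move: y.
apply: (@tensor_ext T T' (fun y => g (y * z)) (fun y => g y * g z)).
- by move=> c x y; rewrite mulrDl -scalerAl linearP.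
- by move=> c x y; rewrite linearP mulrDl -scalerAl.
move=> a b; move: z.
apply: (@tensor_ext T T' (fun z => g (tensor T a b * z)) (fun z => g (tensor T a b) * g z)).
- by move=> c x y; rewrite mulrDr -scalerAr linearP.
- by move=> c x y; rewrite linearP mulrDr -scalerAr.
by move=> a' b'; rewrite tensor_mul !gE tensor_mul.
Qed.

Context (p : nat) (hp : p \in [pchar k]) (e : nat).

(** Conjugate the lift by the isomorphism between the two tensor squares; it is
    again linear over the Frobenius because the isomorphism is multiplicative. *)
Lemma D2_lift T (mu : {linear T -> A}) : (forall a b, mu (tensor T a b) = a * b) ->
  forall phi : frob_hom hp e A, D2 hp e A phi ->
  exists lift : frob_hom hp e T, forall z, mu (lift z) = phi (mu z).
Proof.
move=> muE phi [T' [mu' [lift' [mu'E lift'E]]]].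
have [g gE gM] := tensor_compare T T'; have [h hE hM] := tensor_compare T' T.
have gK : cancel g h.
  apply: (@tensor_ext T T (fun z => h (g z)) id) => [c x y|c x y|a b] //.
    by rewrite !linearP.
  by rewrite gE hE.
have mu_h z : mu (h z) = mu' z.
  move: z; apply: (@tensor_ext T' A (fun z => mu (h z)) mu') => [c x y|c x y|a b].
  - by rewrite !linearP.
  - by rewrite !linearP.
  - by rewrite hE muE mu'E.
pose f (z : frob_push hp e T) : T^o := h (lift' (g z)).
have gX z i : g (z ^+ i) = g z ^+ i.
  elim: i => [|i IH]; first by rewrite !expr0 -!tensor_one gE.
  by rewrite !exprS gM IH.
have fl : linear f.
  move=> r x y; rewrite /f.
  have -> : g (r *: x + y) = (g r : T') *: (g x : frob_push hp e T') + g y.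
    by rewrite linearD; congr (_ + _); rewrite [LHS]gM gX.
  rewrite linearP linearD; congr (_ + _).
  by rewrite [LHS]hM gK.
pose lift : {linear frob_push hp e T -> T^o} :=
  HB.pack f (GRing.isLinear.Build _ _ _ _ f fl).
exists lift => z; rewrite /lift /= /f mu_h lift'E -mu_h gK //.
Qed.

End TensorSquares.

(** * The toric model of the tensor square *)

Section ToricTensorSquare.
Context (k : fieldType) {Rr : realType} {n : nat} (s : set 'rV[Rr]_n).
Hypothesis s0 : s 0.
Local Notation R := (toric_ring k s).
Local Notation RR := (toric_ring k (cone_square s)).
Implicit Types (f g : R) (m : 'rV[int]_n) (u : 'rV[int]_(n + n)) (c : k).

(** k[Z^n] (x) k[Z^n] is identified with k[Z^(n+n)] by concatenating exponents. *)
Definition laurent_tensor (f g : laurent k n) : laurent k (n + n) :=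
  msum (fun m c => msum (fun m' d => mono (c * d) (row_mx m m')) g) f.

Lemma coef_laurent_tensor (f g : laurent k n) u :
  coef u (laurent_tensor f g) = coef (lsubmx u) f * coef (rsubmx u) g.
Proof.
rewrite /laurent_tensor {1}/msum coef_sum.
rewrite [f in RHS]sum_monomials coef_sum mulr_suml; apply: eq_bigr => m _.
rewrite /msum coef_sum [g in RHS]sum_monomials coef_sum mulr_sumr; apply: eq_bigr => m' _.
rewrite !coef_monomial mulrnAl mulrnAr -mulrnA mulnb.
congr (_ *+ nat_of_bool _); rewrite -[u in LHS]hsubmxK.
by apply/eqP/andP => [/eq_row_mx[-> ->]|[/eqP-> /eqP->]].
Qed.

Lemma dual_cone_square_int u : dual_cone (cone_square s) (of_int u) <->
  dual_cone s (of_int (lsubmx u)) /\ dual_cone s (of_int (rsubmx u)).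
Proof. by rewrite -{1}(hsubmxK u) of_int_row_mx; apply: dual_cone_square. Qed.

Lemma laurent_tensor_toric f g : laurent_tensor f g \in in_toric (cone_square s).
Proof.
apply/Defs.in_toricP => u; rewrite -coef_neq0 coef_laurent_tensor mulf_eq0 negb_or.
move=> /andP[hl hr]; apply/dual_cone_square_int.
by split; [move: hl|move: hr]; rewrite coef_neq0; apply: toric_supp.
Qed.

Definition toric_tensor f g : RR := ToricRing (laurent_tensor_toric f g).

Lemma toric_tensorE f g u :
  coef u (toric_val (toric_tensor f g)) = coef (lsubmx u) f * coef (rsubmx u) g.
Proof. exact: coef_laurent_tensor. Qed.

Lemma toric_tensor_linearl g : linear (toric_tensor^~ g).
Proof.
move=> c x y; apply/toric_val_inj/coefP => u.
rewrite toric_valD toric_valZ coefD coefZ !toric_tensorE.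
by rewrite toric_valD toric_valZ coefD coefZ mulrDl mulrA.
Qed.

Lemma toric_tensor_linearr f : linear (toric_tensor f).
Proof.
move=> c x y; apply/toric_val_inj/coefP => u.
rewrite toric_valD toric_valZ coefD coefZ !toric_tensorE.
by rewrite toric_valD toric_valZ coefD coefZ mulrDr mulrCA.
Qed.

Lemma toric_tensor_monomial c d m m' :
  dual_cone s (of_int m) -> dual_cone s (of_int m') ->
  toric_tensor (toric_monomial s c m) (toric_monomial s d m')
    = toric_monomial (cone_square s) (c * d) (row_mx m m').
Proof.
move=> h h'; apply/toric_val_inj/coefP => u.
rewrite toric_tensorE !toric_monomialE //; last first.
  by apply/dual_cone_square_int; rewrite row_mxKl row_mxKr.
rewrite !coef_monomial mulrnAl mulrnAr -mulrnA mulnb.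
congr (_ *+ nat_of_bool _); rewrite -[u in RHS]hsubmxK.
by apply/esym; apply/eqP/andP => [/eq_row_mx[-> ->]|[/eqP-> /eqP->]].
Qed.

Lemma toric_monomial_split c u : dual_cone (cone_square s) (of_int u) ->
  toric_monomial (cone_square s) c u
    = toric_tensor (toric_monomial s c (lsubmx u)) (toric_monomial s 1 (rsubmx u)).
Proof.
move=> /dual_cone_square_int[hl hr].
by rewrite toric_tensor_monomial // hsubmxK mulr1.
Qed.

Lemma toric_tensor_one : toric_tensor 1 1 = 1.
Proof.
have one (N : nat) (t : set 'rV[Rr]_N) : 1 = toric_monomial t 1 0 :> toric_ring k t.
  by apply: toric_val_inj; rewrite toric_monomialE ?monomial1 //; apply: dual_cone0.
rewrite !one toric_tensor_monomial ?mulr1 ?row_mx0 //; exact: dual_cone0.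
Qed.

Lemma linear_add (U W : lmodType k) (F : U -> W) : linear F -> {morph F : x y / x + y}.
Proof. by move=> Fl x y; have := Fl 1 x y; rewrite !scale1r. Qed.

Lemma linear_scale (U W : lmodType k) (F : U -> W) : linear F ->
  forall c x, F (c *: x) = c *: F x.
Proof.
move=> Fl c x; have := Fl c x 0; rewrite !addr0 => ->.
by rewrite (morph_add0 (linear_add Fl)) addr0.
Qed.

Lemma toric_tensor_mul (f g f' g' : R) :
  toric_tensor f g * toric_tensor f' g' = toric_tensor (f * f') (g * g').
Proof.
have Dl g := linear_add (toric_tensor_linearl g).
have Dr f := linear_add (toric_tensor_linearr f).
move: f; apply: toric_additive_ext => [x y|x y|c m hm]; rewrite ?Dl ?mulrDl ?Dl //.
move: g; apply: toric_additive_ext => [x y|x y|d m' hm']; rewrite ?Dr ?mulrDl ?Dr //.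
move: f'; apply: toric_additive_ext => [x y|x y|c' a ha]; rewrite ?Dl ?mulrDr ?Dl //.
move: g'; apply: toric_additive_ext => [x y|x y|d' b hb]; rewrite ?Dr ?mulrDr ?Dr //.
have sq x y : dual_cone s (of_int x) -> dual_cone s (of_int y) ->
    dual_cone (cone_square s) (of_int (row_mx x y)).
  by move=> hx hy; apply/dual_cone_square_int; rewrite row_mxKl row_mxKr.
rewrite !toric_tensor_monomial // !toric_monomialM ?sq // ?toric_tensor_monomial.
- by rewrite add_row_mx mulrACA.
- exact: dual_coneD.
- exact: dual_coneD.
- exact: sq.
- exact: sq.
Qed.

(** The concatenated monomials form a basis of the target, and each is the tensor of
    two monomials of R. *)
Lemma toric_tensor_universal (W : lmodType k) (F : R -> R -> W) :
  (forall g, linear (F^~ g)) -> (forall f, linear (F f)) ->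
  exists2 G : {linear RR -> W}, forall f g, G (toric_tensor f g) = F f g
    & forall G' : {linear RR -> W}, (forall f g, G' (toric_tensor f g) = F f g) -> G' =1 G.
Proof.
move=> Fl Fr.
pose h u := F (toric_monomial s 1 (lsubmx u)) (toric_monomial s 1 (rsubmx u)).
pose G0 (z : RR) : W := msum (fun u c => c *: h u) (toric_val z).
have hD u : {morph (fun c => c *: h u) : x y / x + y} by move=> x y; rewrite scalerDl.
have G0l : linear G0.
  by move=> c x y; rewrite /G0 toric_valD toric_valZ msumD // msumZ.
have G0m c u : dual_cone (cone_square s) (of_int u) ->
    G0 (toric_monomial (cone_square s) c u) = c *: h u.
  by move=> hu; rewrite /G0 toric_monomialE // msum_monomial.
pose G : {linear RR -> W} := HB.pack G0 (GRing.isLinear.Build _ _ _ _ G0 G0l).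
have GE f g : G0 (toric_tensor f g) = F f g.
  have Dl b := linear_add (toric_tensor_linearl b).
  have Dr a := linear_add (toric_tensor_linearr a).
  have FDl b := linear_add (Fl b); have FDr a := linear_add (Fr a).
  have GD := linear_add G0l.
  move: f; apply: toric_additive_ext => [x y|x y|c m hm]; first by rewrite Dl GD.
    exact: FDl.
  move: g; apply: toric_additive_ext => [x y|x y|d m' hm']; first by rewrite Dr GD.
    exact: FDr.
  rewrite toric_tensor_monomial // G0m; last first.
    by apply/dual_cone_square_int; rewrite row_mxKl row_mxKr.
  rewrite /h row_mxKl row_mxKr -(mulr1 c) -toric_monomialZ // -(mulr1 d) -toric_monomialZ //.
  by rewrite (linear_scale (Fl _)) (linear_scale (Fr _)) scalerA !mulr1.
exists G => // G' hG'.
apply: toric_additive_ext => [x y|x y|c u hu]; [exact: linearD|exact: linearD|].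
by rewrite toric_monomial_split // hG' -GE.
Qed.

Definition toric_tensor_square : tensor_square R :=
  TensorSquare toric_tensor_linearl toric_tensor_linearr toric_tensor_one
    toric_tensor_mul toric_tensor_universal.

(** The multiplication map on Laurent polynomials.  It is defined without reference
    to the cones so that it can be applied to the individual terms of a lift. *)
Definition laurent_mul (z : laurent k (n + n)) : laurent k n :=
  msum (fun u c => mono c (lsubmx u + rsubmx u)) z.

Lemma laurent_mulD : {morph laurent_mul : x y / x + y}.
Proof. by apply: msumD => u x y; rewrite monomialD. Qed.

Lemma laurent_mul_mono c u : laurent_mul (mono c u) = mono c (lsubmx u + rsubmx u).
Proof. by rewrite /laurent_mul msum_monomial // => m x y; rewrite monomialD. Qed.

Lemma laurent_mulZ c z : laurent_mul (c *: z) = c *: laurent_mul z.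
Proof.
move: z; apply: additive_ext => [x y|x y|d u].
- by rewrite scalerDr laurent_mulD.
- by rewrite laurent_mulD scalerDr.
- by rewrite monomialZ !laurent_mul_mono monomialZ.
Qed.

Lemma laurent_mul_supp z w : coef w (laurent_mul z) != 0 ->
  exists2 u, u \in msupp z & lsubmx u + rsubmx u = w.
Proof.
move=> hw; apply: contrapT => hn; move/eqP: hw; apply.
rewrite /laurent_mul /msum coef_sum big_seq big1 // => u uz.
by rewrite coef_monomial; case: eqP => // uw; case: hn; exists u.
Qed.

Lemma toric_mul : exists mu : {linear RR -> R},
  (forall f g, mu (toric_tensor f g) = f * g) /\
  (forall z, toric_val (mu z) = laurent_mul (toric_val z)).
Proof.
have [mu muE _] := toric_tensor_universal (W := R) (F := fun f g => f * g)
  (fun g c x y => etrans (mulrDl _ _ _) (congr1 (+%R^~ _) (esym (scalerAl _ _ _))))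
  (fun f c x y => etrans (mulrDr _ _ _) (congr1 (+%R^~ _) (esym (scalerAr _ _ _)))).
exists mu; split=> //; apply: toric_additive_ext => [x y|x y|c u hu].
- by rewrite linearD.
- by rewrite toric_valD laurent_mulD.
rewrite toric_monomialE // laurent_mul_mono toric_monomial_split // muE toric_valM.
case/dual_cone_square_int: hu => hl hr.
by rewrite !toric_monomialE // monomialM mulr1.
Qed.

End ToricTensorSquare.

(** The condition of the theorem on a = b/q, in integral form: c/q is the
    representative of the class of u/q. *)
Definition liftable_point (q n : nat) (I : finType) (v : I -> 'rV[int]_n)
    (b : 'rV[int]_n) : Prop :=
  inner_point q v b /\
  forall u, exists c d, [/\ c = u + d *+ q, inner_point q v c & inner_point q v (b - c)].

(** * The lifting criterion *)

Lemma row_mxMn (V : nmodType) n1 n2 (a : 'rV[V]_n1) (b : 'rV[V]_n2) i :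
  row_mx a b *+ i = row_mx (a *+ i) (b *+ i).
Proof. by elim: i => [|i IH]; rewrite ?mulr0n ?row_mx0 // !mulrS IH add_row_mx. Qed.

Section LiftingCriterion.
Context (k : fieldType) (p : nat) (hp : p \in [pchar k])
  (hperf : forall c : k, exists d : k, d ^+ p = c) (e : nat).
Local Notation q := (p ^ e)%N.
Context {Rr : realType} {n : nat} (s : set 'rV[Rr]_n) (s0 : s 0).
Context (I : finType) (v : I -> 'rV[int]_n).
Hypothesis hv : facet_system s v.
Local Notation R := (toric_ring k s).
Local Notation RR := (toric_ring k (cone_square s)).
Local Notation inner := (inner_point q v).
Local Notation liftable := (liftable_point q v).
Local Notation pi b := (@pi_frac Rr k _ q b).
Implicit Types (b m u w : 'rV[int]_n).

Lemma inner_point_square b1 b2 :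
  inner_point q (facets_square v) (row_mx b1 b2) <-> inner b1 /\ inner b2.
Proof.
split=> [h|[h1 h2] [] i].
- split=> i; first by have := h (inl i); rewrite /= idot_row_mx idot0r addr0.
  by have := h (inr i); rewrite /= idot_row_mx idot0r add0r.
- by rewrite /= idot_row_mx idot0r addr0.
- by rewrite /= idot_row_mx idot0r add0r.
Qed.

(** Given b in the support of g and a class u, choose m and m' in the dual cone with
    m = - u and m + m' = - b modulo q.  Then phi(x^(m+m')) has the nonzero
    coefficient g_b, so the lift does not kill x^m (x) x^m'; a monomial of its
    image comes from a pair of inner points (c, b - c) with c = - m = u
    modulo q. *)
Lemma lift_liftable (phi : frob_hom hp e R) (g : laurent k n) :
  (forall b, b \in msupp g -> inner b) ->
  (forall f : R, toric_val (phi f) = trace_op Rr q g (toric_val f)) ->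
  D2 hp e R phi -> forall b, b \in msupp g -> liftable b.
Proof.
move=> g_inner phiE phiD b bg; split=> [|u]; first exact: g_inner.
have [mu [muE mu_val]] := toric_mul k s0.
have [lift liftE] := D2_lift (T := toric_tensor_square k s0) muE phiD.
have [G G_inner GE] := payne hperf (facet_system_square s0 hv) lift.
have [w1] := residue_lift hp e hv u; set m := _ - u => hm.
have [w2] := residue_lift hp e hv (b + m); set m' := _ - (b + m) => hm'.
have hmm : dual_cone (cone_square s) (of_int (row_mx m m')).
  by apply/dual_cone_square_int; rewrite // row_mxKl row_mxKr.
have : coef w2 (toric_val (phi (mu (toric_monomial _ 1 (row_mx m m'))))) != 0.
  rewrite phiE mu_val toric_monomialE // laurent_mul_mono row_mxKl row_mxKr.
  rewrite (coef_trace_op_mono hp hperf) (qroot1 hp hperf) mul1r.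
  have -> : w2 *+ q - (m + m') = b; last by rewrite coef_neq0.
  by apply/rowP => i; rewrite !mxE; ring.
rewrite -liftE mu_val => /laurent_mul_supp[x xs xw].
move: xs; rewrite -coef_neq0 GE toric_monomialE // (coef_trace_op_mono hp hperf).
rewrite (qroot1 hp hperf) mul1r coef_neq0 => /G_inner.
rewrite -[x]hsubmxK row_mxMn opp_row_mx add_row_mx => /inner_point_square[h1 h2].
exists (lsubmx x *+ q - m), (lsubmx x - w1); split=> //.
  by rewrite /m opprB mulrnBl addrCA addrC.
suff -> : b - (lsubmx x *+ q - m) = rsubmx x *+ q - m' by [].
by rewrite /m' -xw mulrnDl; apply/rowP => i; rewrite !mxE; ring.
Qed.

Lemma pi_mono N (b m w : 'rV[int]_N) (c : k) : b + m = w *+ q ->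
  pi b (mono c m) = mono (qroot q c) w.
Proof.
move=> bm; apply: coefP => x; rewrite (coef_pi_map hp hperf) !coef_monomial.
have -> : (m == x *+ q - b) = (w == x).
  rewrite eq_sym subr_eq addrC bm.
  apply/eqP/eqP => [/rowP xw|->//]; apply/rowP => i; have := xw i.
  by rewrite !mulmxnE => /(pmulrnI (q_gt0 hp e)).
by case: eqP => _; rewrite ?mulr1n ?mulr0n ?(qroot0 hp hperf).
Qed.

Lemma pi_mono0 N (b m : 'rV[int]_N) (c : k) : (forall w : 'rV[int]_N, b + m <> w *+ q) ->
  pi b (mono c m) = 0.
Proof.
move=> bm; apply: coefP => x; rewrite (coef_pi_map hp hperf) coef_monomial coef0.
case: eqP => [mE|_]; last by rewrite (qroot0 hp hperf).
by case: (bm x); rewrite mE addrC subrK.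
Qed.

(** The term of index t vanishes on the monomial x^m (x) x^m' unless rep(t) = - m
    modulo q, which singles out one t; that term sends the monomial to
    x^((rep(t) + m)/q) (x) x^((b - rep(t) + m')/q), whose product is the value
    of pi_b on x^(m + m'), unless the second exponent is not integral; then both
    sides vanish. *)
Lemma laurent_mul_pi (rep : 'rV['I_q]_n -> 'rV[int]_n) b c (x : 'rV[int]_(n + n)) :
  (forall t, exists d, rep t = residue_rep t + d *+ q) ->
  \sum_t laurent_mul (pi (row_mx (rep t) (b - rep t)) (mono c x))
    = pi b (mono c (lsubmx x + rsubmx x)).
Proof.
move=> repE; have [t [d td]] := residue_repP (- lsubmx x) (q_gt0 hp e).
have [d' rt] := repE t.
have rw : rep t + lsubmx x = (d' - d) *+ q.
  by rewrite rt mulrnBl -[lsubmx x]opprK td opprD addrACA subrr add0r.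
have splitE (t' : 'rV['I_q]_n) (w : 'rV[int]_(n + n)) :
    row_mx (rep t') (b - rep t') + x = w *+ q ->
    rep t' + lsubmx x = lsubmx w *+ q /\ b - rep t' + rsubmx x = rsubmx w *+ q.
  rewrite -[in X in X -> _](hsubmxK x) -[in X in X -> _](hsubmxK w).
  by rewrite row_mxMn add_row_mx => /eq_row_mx.
rewrite (bigD1 t) //= big1 ?addr0 => [|t' tt'].
  have [[w bw]|nw] := pselect (exists w, b + (lsubmx x + rsubmx x) = w *+ q).
    rewrite (pi_mono _ bw) (@pi_mono _ _ _ (row_mx (d' - d) (w - (d' - d)))).
      by rewrite laurent_mul_mono row_mxKl row_mxKr subrKC.
    rewrite -{1}(hsubmxK x) row_mxMn add_row_mx; congr row_mx => //.
    by rewrite mulrnBl -bw -rw; apply/rowP => i; rewrite !mxE; ring.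
  rewrite [RHS]pi_mono0 => [|w bw]; last by apply: nw; exists w.
  rewrite pi_mono0 ?(morph_add0 (@laurent_mulD _ _)) // => w /splitE[h1 h2].
  apply: nw; exists (lsubmx w + rsubmx w); rewrite mulrnDl -h1 -h2.
  by apply/rowP => i; rewrite !mxE; ring.
rewrite pi_mono0 ?(morph_add0 (@laurent_mulD _ _)) // => w /splitE[h1 _].
move/negP: tt'; apply; apply/eqP; have [d1 rt'] := repE t'.
apply: (@residue_rep_inj _ _ _ _ (lsubmx w - d1 + d)).
have -> : residue_rep t' = lsubmx w *+ q - lsubmx x - d1 *+ q by rewrite -h1 rt' !addrK.
have -> : residue_rep t = - lsubmx x - d *+ q by rewrite td addrK.
by rewrite mulrnDl mulrnBl; apply/rowP => i; rewrite !mxE; ring.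
Qed.

Lemma liftable_lift (N : nat) (c : 'I_N -> k) (b : 'I_N -> 'rV[int]_n) :
  (forall i, liftable (b i)) ->
  exists2 phi : frob_hom hp e R, D2 hp e R phi
    & forall f : R, toric_val (phi f) = \sum_i c i *: pi (b i) (toric_val f).
Proof.
move=> hb.
have /choice[rep hrep] : forall it : 'I_N * 'rV['I_q]_n, exists r, exists d,
    [/\ r = residue_rep it.2 + d *+ q, inner r & inner (b it.1 - r)].
  by move=> [i t]; have [_ /(_ (residue_rep t))] := hb i.
pose g := \sum_i mono (c i) (b i).
pose G := \sum_i \sum_t mono (c i) (row_mx (rep (i, t)) (b i - rep (i, t))).
have gE f : trace_op Rr q g f = \sum_i c i *: pi (b i) f.
  rewrite (morph_add_sum _ _ _ (trace_opDl p e f)).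
  by apply: eq_bigr => i _; rewrite trace_op_mono.
have GE z : trace_op Rr q G z =
    \sum_i \sum_t c i *: pi (row_mx (rep (i, t)) (b i - rep (i, t))) z.
  rewrite (morph_add_sum _ _ _ (trace_opDl p e z)); apply: eq_bigr => i _.
  rewrite (morph_add_sum _ _ _ (trace_opDl p e z)); apply: eq_bigr => t _.
  by rewrite trace_op_mono.
have in_support (x : 'rV[int]_n) : x \in msupp g -> inner x.
  rewrite -coef_neq0 coef_sum => xg; apply: contrapT => hx.
  move/eqP: xg; apply; rewrite big1 // => i _; rewrite coef_monomial.
  by case: eqP => // bx; case: hx; rewrite -bx; case: (hb i).
have in_supportG (x : 'rV[int]_(n + n)) :
    x \in msupp G -> inner_point q (facets_square v) x.
  rewrite -coef_neq0 coef_sum => xG; apply: contrapT => hx.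
  move/eqP: xG; apply; rewrite big1 // => i _; rewrite coef_sum big1 // => t _.
  rewrite coef_monomial; case: eqP => // rx; case: hx; rewrite -rx.
  by apply/inner_point_square; have [d []] := hrep (i, t).
have [phi phiE] := frob_hom_of hp (trace_op_toric hp hperf hv in_support)
  (fun x y => trace_opDr hp hperf e g (toric_val x) (toric_val y))
  (fun x y => etrans (congr1 (fun z => trace_op Rr q g (z * _)) (toric_valX x q))
     (trace_op_frobenius hp hperf e g _ (toric_val y))).
have [lift liftE] := frob_hom_of hp
  (trace_op_toric hp hperf (facet_system_square s0 hv) in_supportG)
  (fun x y => trace_opDr hp hperf e G (toric_val x) (toric_val y))
  (fun x y => etrans (congr1 (fun z => trace_op Rr q G (z * _)) (toric_valX x q))
     (trace_op_frobenius hp hperf e G _ (toric_val y))).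
exists phi => [|f]; last by rewrite phiE gE.
have [mu [muE mu_val]] := toric_mul k s0.
exists (toric_tensor_square k s0), mu, lift; split=> // z; apply: toric_val_inj.
rewrite phiE mu_val mu_val liftE; move: (toric_val z) => {}z.
move: z; apply: additive_ext => [x y|x y|d x].
- by rewrite (trace_opDr hp hperf) laurent_mulD.
- by rewrite laurent_mulD (trace_opDr hp hperf).
rewrite laurent_mul_mono gE GE (morph_add_sum _ _ _ (@laurent_mulD _ _)).
apply: eq_bigr => i _; rewrite (morph_add_sum _ _ _ (@laurent_mulD _ _)).
rewrite -(@laurent_mul_pi (fun t => rep (i, t))) => [|t]; last first.
  by have [d' []] := hrep (i, t); exists d'.
by rewrite scaler_sumr; apply: eq_bigr => t _; rewrite laurent_mulZ.
Qed.

End LiftingCriterion.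

(** * The criterion in terms of the polytope *)

Section PolytopeCriterion.
Context (k : fieldType) (p : nat) (hp : p \in [pchar k]) (e : nat).
Local Notation q := (p ^ e)%N.
Context {Rr : realType} {n : nat} (I : finType) (v : I -> 'rV[int]_n).
Hypothesis v0 : forall i, v i != 0.
Local Notation frac b := (fracpt Rr q b).
Implicit Types (b c u w : 'rV[int]_n).

Let P : set 'rV[Rr]_n := [set x | forall i, -1 <= dot x (of_int (v i))].

Let rv0 i : of_int (v i) != 0 :> 'rV[Rr]_n.
Proof. by rewrite -of_int0 (inj_eq (@of_int_inj Rr n)). Qed.

Lemma fracptB b c : frac (b - c) = frac b - frac c.
Proof. by rewrite /fracpt of_intB scalerBr. Qed.

Lemma frac_latticeP (x : 'rV[Rr]_n) : frac_lattice q x <-> exists b, x = frac b.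
Proof.
split=> [[_ [b _ <-] <-]|[b ->]]; first by exists b.
by exists (of_int b) => //; exists b.
Qed.

Lemma lattice_frac b : lattice (frac b) <-> exists d, b = d *+ q.
Proof.
split=> [[d _ /esym]|[d bd]].
  by move=> /(fracpt_lattice hp)->; exists d.
by exists d => //; apply/esym/(fracpt_lattice hp).
Qed.

Lemma frac_gtN1 b i : (-1 < dot (frac b) (of_int (v i))) = (- q%:Z < idot b (v i)).
Proof.
have q0 : 0 < q%:R :> Rr by rewrite ltr0n (q_gt0 hp).
rewrite /fracpt dotZl dot_of_int -(ltr_pM2l q0) mulrA mulfV ?gt_eqF // mul1r mulrN1.
by rewrite -(ltr_int Rr) rmorphN.
Qed.

Lemma interior_polytope b : interior P (frac b) <-> inner_point q v b.
Proof.
by rewrite /P interior_halfspaces //; split=> h i; have := h i; rewrite /= frac_gtN1.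
Qed.

(** The reflected polytope is again an intersection of half spaces, with normals the
    - v_i. *)
Lemma interior_reflected b c :
  interior [set frac b - x | x in P] (frac c) <-> inner_point q v (b - c).
Proof.
have -> : [set frac b - x | x in P] =
    [set x | forall i, - (1 + dot (frac b) (of_int (v i))) <= dot x (- of_int (v i))].
  apply/seteqP; split=> x.
    move=> [y Py <-] i; rewrite dotNr dotBl; have := Py i; lra.
  move=> h; exists (frac b - x); last by rewrite subKr.
  by move=> i; rewrite dotBl; have := h i; rewrite dotNr; lra.
rewrite interior_halfspaces => [|i]; last by rewrite oppr_eq0.
split=> h i; have := h i; rewrite -frac_gtN1 /= fracptB dotBl dotNr; lra.
Qed.

Lemma liftable_pointP b :
  liftable_point q v b <->
  interior P (frac b) /\
  forall x : 'rV[Rr]_n, frac_lattice q x -> exists w : 'rV[Rr]_n, [/\ frac_lattice q w, lattice (w - x)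
    & interior (P `&` [set frac b - y | y in P]) w].
Proof.
rewrite interior_polytope interiorI; split=> -[hb hc]; split=> //.
  move=> x /frac_latticeP[u ->]; have [c [d [cE c1 c2]]] := hc u.
  exists (frac c); split; first by apply/frac_latticeP; exists c.
    by rewrite -fracptB; apply/lattice_frac; exists d; rewrite cE addrC addKr.
  by split; [apply/interior_polytope|apply/interior_reflected].
move=> u; have [|w [/frac_latticeP[c ->]]] := hc (frac u).
  by apply/frac_latticeP; exists u.
rewrite -fracptB => /lattice_frac[d cu] [/interior_polytope c1 /interior_reflected c2].
by exists c, d; split=> //; rewrite -cu addrC subrK.
Qed.

End PolytopeCriterion.

Unset Implicit Arguments.
Theorem theoremC (Rr : realType) (k : fieldType) (p : nat)
    (hp : p \in [pchar k])
    (hperf : forall c : k, exists d : k, d ^+ p = c)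
    (n : nat) (sigma : set 'rV[Rr]_n)
    (hpoly : rational_polyhedral_cone sigma)
    (hconv : strongly_convex sigma)
    (hdim : cone_dim sigma n)
    (e : nat) (he : (0 < e)%N) :
  let q := (p ^ e)%N in
  let R := toric_ring k sigma in
  let P := anticanonical_polytope (face_fan sigma) in
  [set (fun f : R => toric_val (phi f)) | phi in D2 hp e R] =
  k_span [set (fun f : R => pi_map q a (toric_val f)) |
    a in [set a : 'rV[Rr]_n |
      [/\ frac_lattice q a,
          interior P a
        & forall u, frac_lattice q u ->
            exists w, [/\ frac_lattice q w, lattice (w - u)
                        & interior (P `&` [set a - v | v in P]) w]]]].
Proof.
move=> q R P.
have s0 : sigma 0.
  by have : [set 0 : 'rV[Rr]_n] 0 by []; rewrite -hconv => -[].
have [r [v [hv PE]]] := toric_facets hpoly hconv.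
have v0 i : v i != 0.
  by have [w] := facet_primitive hv i; apply: contra_eqN => /eqP->; rewrite idot0r.
have piE b (f : R) : pi_map q (fracpt Rr q b) f = pi_frac Rr q b f.
  by rewrite pi_frac.unlock.
have spanE N (c : 'I_N -> k) (G : 'I_N -> R -> laurent k n) :
    \sum_i c i *: G i = fun f => \sum_i c i *: G i f.
  by apply/funext => f; rewrite fct_sumE.
apply/seteqP; split=> F.
  move=> [phi phiD <-]; have [g g_inner phiE] := payne hperf hv phi.
  have gL := lift_liftable hperf s0 hv g_inner phiE phiD.
  pose b (i : 'I_(size (msupp g))) := nth 0 (msupp g) i.
  exists (size (msupp g)), (fun i => coef (b i) g),
    (fun i (f : R) => pi_map q (fracpt Rr q (b i)) f); split.
    move=> i; exists (fracpt Rr q (b i)) => //.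
    have /(liftable_pointP (Rr := Rr) hp e v0)[h1 h2] : liftable_point q v (b i).
      by apply/gL/mem_nth.
    by split; [apply/(frac_latticeP p e); exists (b i)|rewrite /P PE|rewrite /P PE].
  rewrite spanE; apply/funext => f; rewrite phiE /trace_op /msum.
  rewrite (big_nth 0) big_mkord; apply: eq_bigr => i _.
  by rewrite piE.
move=> [N [c [G [GS ->]]]].
have /choice[b hb] : forall i, exists b, liftable_point q v b /\
    G i = (fun f : R => pi_map q (fracpt Rr q b) f).
  move=> i; have [a [/(frac_latticeP p e)[b ->] h1 h2] <-] := GS i.
  exists b; split=> //; apply/(liftable_pointP (Rr := Rr) hp e v0).
  by move: h1 h2; rewrite /P PE.
have [phi phiD phiE] := liftable_lift hp hperf s0 hv c (fun i => (hb i).1).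
exists phi => //; rewrite spanE; apply/funext => f; rewrite phiE.
by apply: eq_bigr => i _; rewrite (hb i).2 piE.
Qed.
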